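(* Let $X$ be a graph whose group of isometries acts cocompactly. If $X$ is quasi-isometric to a tree, then $X$ is LG-rigid.
   Context: A ''graph'' means a connected, locally finite graph without loops or multiple edges, equipped with the geodesic metric giving each edge length $1$; ''$x\in X$'' means that $x$ is a vertex of $X$; balls are closed balls. The isometry group acts cocompactly if it has finitely many orbits of vertices. A covering from a graph $X$ to a graph $Y$ is a graph covering map (a surjective graph morphism which, for every vertex $x$, maps the neighbors of $x$ bijectively onto the neighbors of its image); $Y$ is covered by $X$ if such a map $X\to Y$ exists. Given a graph $X$ and $R>0$, a graph $Y$ is $R$-locally $X$ if for every vertex $y\in Y$ there exists $x\in X$ such that the balls $B_X(x,R)$ and $B_Y(y,R)$, equipped with their intrinsic geodesic metrics, are isometric. $X$ is LG-rigid at scale $R$ if every graph which is $R$-locally $X$ is covered by $X$. $X$ is LG-rigid if it is LG-rigid at scale $R$ for some $R>0$. *)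

(* Defs.v *)
From HB Require Import structures.
From mathcomp Require Import all_boot all_order all_algebra.
From mathcomp Require Import all_classical all_reals all_analysis.

Set Implicit Arguments.
Unset Strict Implicit.
Unset Printing Implicit Defensive.

Import Order.TTheory GRing.Theory Num.Theory.

Local Open Scope classical_set_scope.
Local Open Scope ring_scope.

(* Connected graphs are nonempty by convention. *)
Record graph := Graph {
  vertex :> eqType;
  adj : rel vertex;
  graph_nonempty : inhabited vertex;
  adj_irreflexive : irreflexive adj;
  adj_symmetric : symmetric adj;
  graph_connected :
    forall x y : vertex, exists2 p : seq vertex, path adj x p & y = last x p;
  graph_locally_finite :
    forall x : vertex, finite_set [set y : vertex | adj x y] }.

Definition is_tree (T : graph) : Prop :=
  forall c : seq T, ucycle (@adj T) c -> (size c <= 2)%N.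

Definition is_covering (X Y : graph) (f : X -> Y) : Prop :=
  set_surj [set: X] [set: Y] f /\
  forall x : X, set_bij [set z : X | adj x z] [set z : Y | adj (f x) z] f.

Definition covered_by (Y X : graph) : Prop :=
  exists f : X -> Y, is_covering f.

Section Metric.
Variable R : realType.

(* The points of the metric graph X are given by their barycentric coordinates
   X -> R. The point of the edge {u, v} at distance t from u is
   edge_point u v t, which equals edge_point v u (1 - t). *)
Definition vertex_point (X : graph) (x : X) : X -> R :=
  fun w => (w == x)%:R.

Definition edge_point (X : graph) (u v : X) (t : R) : X -> R :=
  fun w => (1 - t) * (w == u)%:R + t * (w == v)%:R.

Definition realization (X : graph) : set (X -> R) :=
  [set p | (exists x : X, p = vertex_point x) \/
           (exists u v : X, exists t : R,
              [/\ adj u v, 0 <= t <= 1 & p = edge_point u v t])].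

(* path_length A p q l : some path from p to q inside A, made of finitely many
   subsegments of edges, has length l. An edge is traversed from u to v;
   exchanging u and v gives the other direction. *)
Inductive path_length (X : graph) (A : set (X -> R)) :
    (X -> R) -> (X -> R) -> R -> Prop :=
| path_length_nil p : A p -> path_length A p p 0
| path_length_cons (u v : X) (s t : R) (q : X -> R) (l : R) :
    adj u v -> 0 <= s -> s <= t -> t <= 1 ->
    (forall r : R, s <= r <= t -> A (edge_point u v r)) ->
    path_length A (edge_point u v t) q l ->
    path_length A (edge_point u v s) q ((t - s) + l).

(* The value is +oo when A contains no path from p to q. *)
Definition intrinsic_dist (X : graph) (A : set (X -> R)) (p q : X -> R) :
    \bar R :=
  ereal_inf [set l%:E | l in path_length A p q].

Definition geodesic_dist (X : graph) : (X -> R) -> (X -> R) -> \bar R :=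
  intrinsic_dist (@realization X).

Definition graph_ball (X : graph) (x : X) (r : R) : set (X -> R) :=
  [set p | realization p /\ (geodesic_dist (vertex_point x) p <= r%:E)%E].

Definition is_isometry (X Y : graph) (A : set (X -> R)) (B : set (Y -> R))
    (f : (X -> R) -> (Y -> R)) : Prop :=
  set_bij A B f /\
  forall p q, A p -> A q ->
    intrinsic_dist B (f p) (f q) = intrinsic_dist A p q.

Definition isometric (X Y : graph) (A : set (X -> R)) (B : set (Y -> R)) :
    Prop :=
  exists f : (X -> R) -> (Y -> R), is_isometry A B f.

Definition vertex_orbit (X : graph) (x : X) : set X :=
  [set y | exists2 g : (X -> R) -> (X -> R),
     is_isometry (@realization X) (@realization X) g &
     g (vertex_point x) = vertex_point y].

Definition isometries_cocompact (X : graph) : Prop :=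
  finite_set [set vertex_orbit x | x in [set: X]].

Definition quasi_isometric (X Y : graph) : Prop :=
  exists (f : (X -> R) -> (Y -> R)) (L C : R),
    [/\ 1 <= L, 0 <= C,
        forall p, realization p -> realization (f p),
        forall p q, realization p -> realization q ->
          (L^-1%:E * geodesic_dist p q - C%:E <= geodesic_dist (f p) (f q)
             <= L%:E * geodesic_dist p q + C%:E)%E &
        forall q : Y -> R, realization q ->
          exists2 p, realization p & (geodesic_dist (f p) q <= C%:E)%E].

Definition is_locally (r : R) (X Y : graph) : Prop :=
  forall y : Y, exists x : X, isometric (graph_ball x r) (graph_ball y r).

Definition LG_rigid_at (r : R) (X : graph) : Prop :=
  forall Y : graph, is_locally r X Y -> covered_by Y X.

Definition LG_rigid (X : graph) : Prop :=
  exists2 r : R, 0 < r & LG_rigid_at r X.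

End Metric.

(* Main.v *)
Require Import Defs.
From HB Require Import structures.
From mathcomp Require Import all_boot all_order all_algebra.
From mathcomp Require Import all_classical all_reals all_analysis.
From mathcomp Require Import zify lra.

(* The tree enters through one fact: three walks joining three vertices of X
   pairwise all pass near a common point, because their images in the tree pass
   near the median. Hence two vertices at distance n from a base vertex o that are
   joined outside the ball of radius n - 1 are at bounded distance D. The pieces
   so obtained form a tree, with pieces of diameter at most D. Since X has finitely
   many orbits of vertices, a partial isomorphism between sufficiently large balls
   of X agrees, near the center, with partial isomorphisms of any prescribed
   radius. So a local isomorphism X -> Y chosen on one piece can be replaced on
   the next piece by one of full radius that agrees with it on both pieces, and
   these glue, piece by piece, to a covering.

   The isometries of the hypothesis are isometries of metric balls and need
   respect neither centers nor vertices. Moving a long geodesic near the center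
   shows that centers are displaced by a bounded amount. The number of points on
   small spheres identifies the vertices of degree other than 2, and then all
   vertices; if every vertex of X has degree 2, then X and Y are lines or cycles
   and the covering is explicit. *)

Set Implicit Arguments.
Unset Strict Implicit.
Unset Printing Implicit Defensive.

Import Order.TTheory GRing.Theory Num.Theory.

Local Open Scope classical_set_scope.

#[local] Arguments adj {g}.

(** * Graph distance *)

Section Distance.
Variable X : graph.
Implicit Types (x y z : X) (p : seq X).

Lemma walk_size_ex x y :
  exists n, `[< exists2 p, path adj x p & y = last x p /\ size p = n >].
Proof.
have [p Hp Hl] := graph_connected x y.
by exists (size p); apply/asboolP; exists p.
Qed.

Definition dist x y : nat := ex_minn (walk_size_ex x y).

Lemma distP x y :
  exists2 p, path adj x p & y = last x p /\ size p = dist x y.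
Proof. by rewrite /dist; case: ex_minnP => n /asboolP. Qed.

Lemma dist_le_size x p : path adj x p -> dist x (last x p) <= size p.
Proof.
move=> Hp; rewrite /dist; case: ex_minnP => n _; apply.
by apply/asboolP; exists p.
Qed.

Lemma distxx x : dist x x = 0.
Proof. by apply/eqP; rewrite -leqn0; apply: (@dist_le_size x [::]). Qed.

Lemma dist0_eq x y : dist x y = 0 -> x = y.
Proof.
by have [p _ [-> <-]] := distP x y; case: p.
Qed.

Lemma distC_le x y : dist y x <= dist x y.
Proof.
have [p Hp [Hl <-]] := distP x y.
have Hr : path adj y (rev (belast x p)).
  by rewrite Hl rev_path -(eq_path (e := adj)) // => u v; rewrite adj_symmetric.
have <- : last y (rev (belast x p)) = x.
  case: p Hl {Hp Hr} => [|a p] /=; first by move=> ->.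
  by move=> _; rewrite rev_cons last_rcons.
by rewrite (leq_trans (dist_le_size Hr)) // size_rev size_belast.
Qed.

Lemma distC x y : dist x y = dist y x.
Proof. by apply/eqP; rewrite eqn_leq !distC_le. Qed.

Lemma dist_triangle y x z : dist x z <= dist x y + dist y z.
Proof.
have [p Hp [Hpl <-]] := distP x y; have [q Hq [Hql <-]] := distP y z.
rewrite -size_cat Hql Hpl -last_cat; apply: dist_le_size.
by rewrite cat_path Hp -Hpl.
Qed.

Lemma adj_neq x y : adj x y -> x <> y.
Proof. by move=> + E; rewrite E adj_irreflexive. Qed.

Lemma adj_dist x y : adj x y -> dist x y = 1.
Proof.
move=> a; apply/eqP; rewrite eqn_leq; apply/andP; split.
  by apply: (@dist_le_size x [:: y]); rewrite /= a.
by rewrite lt0n; apply/eqP => /dist0_eq; apply: adj_neq.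
Qed.

Lemma dist1_adj x y : dist x y = 1 -> adj x y.
Proof.
have [p + [-> <-]] := distP x y.
by case: p => [|a [|b p]] //=; rewrite andbT.
Qed.

Lemma dist_adj x y z : adj y z -> dist x z <= (dist x y).+1.
Proof. by move=> /adj_dist H; rewrite -addn1 -H dist_triangle. Qed.

Lemma geodesicP x y : exists p, [/\ path adj x p, y = last x p &
  forall z, z \in x :: p -> dist x z + dist z y = dist x y].
Proof.
have [p Hp [Hl Hs]] := distP x y; exists p; split=> // z.
rewrite inE => /orP[/eqP->|]; first by rewrite distxx.
move=> /splitPr zp; case: zp Hp Hl Hs => p1 p2.
rewrite cat_path /= => /and3P[H1 H2 H3]; rewrite last_cat /= => Hl Hs.
have L1 : dist x z <= (size p1).+1.
  have := @dist_le_size x (rcons p1 z); rewrite rcons_path H1 H2 last_rcons.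
  by rewrite size_rcons; apply.
have L2 : dist z y <= size p2 by rewrite Hl; apply: dist_le_size.
by have := dist_triangle z x y; move: Hs; rewrite size_cat /=; lia.
Qed.

Lemma geodesic_point x y n : n <= dist x y ->
  exists z, dist x z = n /\ dist x z + dist z y = dist x y.
Proof.
have [p [Hp Hl Hg]] := geodesicP x y.
move=> Hn.
have Hs : dist x y <= size p by rewrite Hl dist_le_size.
(* Discrete intermediate value argument: along [p] the distance from [x] grows by at most one at
   each step, so it takes the value [n] on the way. *)
suff H : forall i, i <= size p -> n <= dist x (last x (take i p)) ->
    exists2 j, j <= i & dist x (last x (take j p)) = n.
  have [|j Hj Ej] := H (size p) (leqnn _); first by rewrite take_size -Hl.
  exists (last x (take j p)); split => //; apply: Hg.
  have := mem_last x (take j p); rewrite !inE => /orP[->//|/mem_take->].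
  by rewrite orbT.
elim=> [|i IH] Hi; first by rewrite take0 /= distxx leqn0 => /eqP->; exists 0; rewrite ?take0 //= distxx.
move=> Hd; case: (leqP n (dist x (last x (take i p)))) => Hc.
  by have [j ? ?] := IH (ltnW Hi) Hc; exists j => //; apply: leqW.
exists i.+1 => //; move: Hd; rewrite (take_nth x Hi) last_rcons => Hd.
have := @dist_adj x (last x (take i p)) (nth x p i).
have /pathP := Hp => /(_ x i Hi).
have -> : nth x (x :: p) i = last x (take i p).
  case: i Hi {IH Hc Hd} => [|i] Hi /=; first by rewrite take0.
  by rewrite (take_nth x (ltnW Hi)) last_rcons.
by move=> -> /(_ isT); lia.
Qed.

Lemma lower_neighbor o x : 0 < dist o x ->
  exists z, adj x z /\ (dist o z).+1 = dist o x.
Proof.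
move=> H; have [z [Hz1 Hz2]] := @geodesic_point o x (dist o x).-1 (leq_pred _).
exists z; split; last by lia.
by rewrite adj_symmetric; apply: dist1_adj; lia.
Qed.

Lemma finite_ball x n : finite_set [set y | dist x y <= n].
Proof.
elim: n => [|n IH].
  apply: (@sub_finite_set _ _ [set x]); last exact: finite_set1.
  by move=> y /=; rewrite leqn0 => /eqP/dist0_eq->.
apply: (@sub_finite_set _ _
  ([set y | dist x y <= n] `|` \bigcup_(z in [set y | dist x y <= n]) [set y | adj z y])).
  move=> y /=; rewrite leq_eqVlt => /orP[/eqP H|]; last by left.
  right; have [|z [a E]] := @lower_neighbor x y; first by rewrite H.
  by exists z => /=; [lia | rewrite adj_symmetric].
rewrite finite_setU; split => //; apply: bigcup_finite => // z _.
exact: graph_locally_finite.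
Qed.

End Distance.

(** * Trees and graphs quasi-isometric to trees *)

Lemma rev_walk (X : graph) (x : X) (p : seq X) : path adj x p ->
  exists q, [/\ path adj (last x p) q, last (last x p) q = x &
    last x p :: q =i x :: p].
Proof.
move=> Hp; exists (rev (belast x p)).
have E : last x p :: rev (belast x p) = rev (x :: p).
  by rewrite [x :: p]lastI rev_rcons.
split; last by move=> z; rewrite E mem_rev.
  by rewrite rev_path -(eq_path (e := adj)) // => u v; rewrite adj_symmetric.
by case: p {Hp E} => [|a p] //=; rewrite rev_cons last_rcons.
Qed.

Lemma prefix_walk (X : graph) (x m : X) (p : seq X) :
  path adj x p -> uniq (x :: p) -> m \in x :: p ->
  exists q, [/\ path adj x q, uniq (x :: q), last x q = m &
    {subset x :: q <= x :: p}].
Proof.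
move=> Hp Up; rewrite inE => /orP[/eqP->|mp].
  by exists [::]; split => // z; rewrite inE => /eqP->; rewrite mem_head.
case/splitPr: mp Hp Up => r1 r2.
rewrite -cat_rcons cat_path => /andP[Hr _] Ur.
exists (rcons r1 m); split => //; rewrite ?last_rcons //.
  by move: Ur; rewrite -cat_cons cat_uniq => /andP[].
by move=> z H; rewrite -cat_cons mem_cat H.
Qed.

Section Tree.
Variables (T : graph) (treeT : is_tree T).
Implicit Types (x y z : T) (p q : seq T).

(** A walk from [a] to [b] avoiding [x], once made simple, closes up through [x] to a cycle with at
    least three vertices. *)
Lemma tree_no_detour x a b p : adj x a -> adj x b -> a <> b ->
  path adj a p -> last a p = b -> x \in a :: p.
Proof.
move=> xa xb ab Hp Hl; apply/negPn/negP => Hx.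
case: (shortenP Hp) Hl => p' Hp' Up' Hsub Hl.
have Hx' : x \notin a :: p'.
  apply: contra Hx; rewrite !inE => /orP[->//|/Hsub].
  by move=> ->; rewrite orbT.
have : ucycle adj (x :: a :: p').
  apply/andP; split; last by rewrite /= Hx' -/(uniq (a :: p')) Up'.
  by rewrite /cycle /= xa rcons_path Hp' Hl adj_symmetric.
move=> /treeT; case: p' Hl {Hp' Up' Hsub Hx'} => //= Hl.
Qed.

(** At the first place where the two paths part, one followed by the reverse of the other joins two
    neighbors of [x] without meeting [x], against [tree_no_detour]. *)
Lemma tree_uniq_path x p q : path adj x p -> path adj x q ->
  uniq (x :: p) -> uniq (x :: q) -> last x p = last x q -> p = q.
Proof.
elim: p x q => [|a p IH] x [|b q] //.
- by move=> _ _ _ /andP[+ _] /= E; rewrite E mem_last.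
- by move=> _ _ /andP[+ _] _ /= E; rewrite -E mem_last.
rewrite [path _ _ _]/= [X in _ -> X -> _]/= => /andP[xa Hp] /andP[xb Hq].
move=> /andP[Nxp Up] /andP[Nxq Uq] El.
have [E|/eqP ab] := eqVneq a b; first by subst b; rewrite (IH a q).
have [r [Hr1 Hr2 Hr3]] := rev_walk Hq.
have : x \in a :: p ++ r.
  apply: (tree_no_detour xa xb ab).
    by rewrite cat_path Hp (_ : last a p = last b q).
  by rewrite last_cat (_ : last a p = last b q).
rewrite -cat_cons mem_cat (negbTE Nxp) /= => H.
by move: Nxq; rewrite -Hr3 inE H orbT.
Qed.

(** All walks are considered, not only simple ones, because the walks obtained from images of walks
    of [X] may backtrack. The vertex [m] may be an end. *)
Definition separates (m x y : T) : Prop :=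
  forall q, path adj x q -> last x q = y -> m \in x :: q.

Lemma separatesC m x y : separates m x y -> separates m y x.
Proof.
move=> H q Hq Hl; have [r [Hr1 Hr2 Hr3]] := rev_walk Hq.
by rewrite -Hr3 Hl; apply: H; rewrite -Hl.
Qed.

Lemma simple_separates x p : path adj x p -> uniq (x :: p) ->
  forall z, z \in x :: p -> separates z x (last x p).
Proof.
move=> Hp Up z zp q Hq Hl; case: (shortenP Hq) Hl => q' Hq' Uq' Hs Hl.
move: zp; rewrite (tree_uniq_path Hp Hq' Up Uq' (esym Hl)) !inE.
by case/orP => [->//|/Hs ->]; rewrite orbT.
Qed.

Lemma first_hit (P : pred T) s q : P (last s q) ->
  exists q1 q2, [/\ q = q1 ++ q2, P (last s q1) &
    forall z, z \in belast s q1 -> ~~ P z].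
Proof.
elim: q s => [|a q IH] s /=; first by move=> H; exists [::], [::].
case: (boolP (P s)) => Ps H; first by exists [::], (a :: q).
have [q1 [q2 [-> H1 H2]]] := IH _ H; exists (a :: q1), q2; split => // z.
by rewrite inE => /orP[/eqP->|/H2].
Qed.

(** The median is the first vertex [m] at which a simple path from [s] to [x] meets the simple path
    [p] from [x] to [y]. *)
Lemma median x y s : exists m,
  [/\ separates m x y, separates m y s & separates m x s].
Proof.
have [p0 Hp0 Hl0] := graph_connected x y.
case: (shortenP Hp0) Hl0 => p Hp Up _ Hl {p0 Hp0}.
have [q0 Hq0 Hlq0] := graph_connected s x.
case: (shortenP Hq0) Hlq0 => q Hq Uq _ Hlq {q0 Hq0}.
have [|q1 [q2 [Eq Hm Hb]]] := @first_hit (mem (x :: p)) s q.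
  by rewrite -Hlq; apply: mem_head.
set m := last s q1 in Hm.
have Hq1 : path adj s q1 by move: Hq; rewrite Eq cat_path => /andP[].
have Uq1 : uniq (s :: q1) by move: Uq; rewrite Eq -cat_cons cat_uniq => /andP[].
have Hb' : forall z, z \in s :: q1 -> z \in x :: p -> z = m.
  move=> z; rewrite lastI mem_rcons inE => /orP[/eqP//|/Hb /= Nz H].
  by rewrite H in Nz.
(* A piece of [p] ending at [m] and the reversed path from [s] to [m] meet only at [m], so their
   concatenation is simple and therefore met by every walk between its ends. *)
have key : forall u r, path adj u r -> uniq (u :: r) -> last u r = m ->
    {subset u :: r <= x :: p} -> separates m u s.
  move=> u r Hr Ur Hlr Hsub.
  have [w [Hw1 Hw2 Hw3]] := rev_walk Hq1.
  rewrite -/m in Hw1 Hw2 Hw3.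
  case: (shortenP Hw1) Hw2 => w' Hw1' Uw' Hs Hw2.
  have Hpath : path adj u (r ++ w') by rewrite cat_path Hr Hlr.
  have <- : last u (r ++ w') = s by rewrite last_cat Hlr.
  apply: simple_separates => //.
    have /andP[Nm Uw2] : (m \notin w') && uniq w' by [].
    rewrite -cat_cons cat_uniq Ur Uw2 andbT.
    apply/hasPn => z zw; apply/negP => zr.
    have zm : z = m.
      by apply: Hb'; [rewrite -Hw3 inE Hs ?orbT | apply: Hsub].
    by rewrite -zm zw in Nm.
  by rewrite -cat_cons mem_cat -Hlr mem_last.
exists m; split.
- by rewrite Hl; apply: simple_separates.
- have [r0 [Hr1 Hr2 Hr3]] := rev_walk Hp; rewrite -Hl in Hr1 Hr2 Hr3.
  case: (shortenP Hr1) Hr2 => r Hr Ur Hs Hr2.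
  have Hym : m \in y :: r.
    have S : separates m x y by rewrite Hl; apply: simple_separates.
    exact: (separatesC S).
  have Hsub : {subset y :: r <= x :: p}.
    by move=> z; rewrite -Hr3 !inE => /orP[->//|/Hs->]; rewrite orbT.
  have [r1 [H1 H2 H3 H4]] := prefix_walk Hr Ur Hym.
  by apply: (key _ r1) => // z /H4/Hsub.
- have [r1 [H1 H2 H3 H4]] := prefix_walk Hp Up Hm.
  exact: (key _ r1).
Qed.

End Tree.

Section QuasiTree.
Variables (X T : graph) (treeT : is_tree T) (F : X -> T) (L C : nat).
Hypothesis F_upper : forall x y, dist (F x) (F y) <= L * dist x y + C.
Hypothesis F_lower : forall x y, dist x y <= L * dist (F x) (F y) + C.

Let K := L + C.

(** Images of consecutive vertices are joined by geodesics of length at most [K]. If [m] misses the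
    first of these, it still separates [F z] from the last image, and the induction continues;
    otherwise [F x] is within [K] of [m]. *)
Lemma walk_near_separator m x s : path adj x s -> separates m (F x) (F (last x s)) ->
  exists2 a, a \in x :: s & dist (F a) m <= K.
Proof.
elim: s x => [|z s IH] x /=.
  move=> _ /(_ [::] isT erefl); rewrite inE => /eqP->; exists x; rewrite ?mem_head //.
  by rewrite distxx.
move=> /andP[xz Hs] Hsep.
have [p [Hp1 Hp2 Hp3]] := geodesicP (F x) (F z).
have HK : dist (F x) (F z) <= K by have := F_upper x z; rewrite (adj_dist xz) /K; lia.
case: (boolP (m \in F x :: p)) => Hm.
  by exists x; [rewrite mem_head | have := Hp3 _ Hm; lia].
have [|a Ha1 Ha2] := IH z Hs.
  move=> w Hw Hl; have := Hsep (p ++ w).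
  rewrite cat_path Hp1 -Hp2 Hw last_cat -Hp2 => /(_ isT Hl).
  rewrite -cat_cons mem_cat (negbTE Hm) /= inE => ->.
  by rewrite orbT.
by exists a => //; rewrite inE Ha1 orbT.
Qed.

(** Bounds the distance of two vertices whose images lie within [K] of a common vertex. *)
Definition tripod_const := L * (2 * K) + C.

Lemma tripod u v w s1 s2 s3 :
  path adj u s1 -> last u s1 = v -> path adj v s2 -> last v s2 = w ->
  path adj u s3 -> last u s3 = w ->
  exists a b c : X, [/\ a \in u :: s1, b \in v :: s2, c \in u :: s3 &
   [/\ dist a b <= tripod_const, dist b c <= tripod_const
     & dist a c <= tripod_const]].
Proof.
move=> H1 E1 H2 E2 H3 E3.
have [m [S1 S2 S3]] := median treeT (F u) (F v) (F w).
have [|a Ia Ha] := walk_near_separator (m := m) H1; first by rewrite E1.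
have [|b Ib Hb] := walk_near_separator (m := m) H2; first by rewrite E2.
have [|c Ic Hc] := walk_near_separator (m := m) H3; first by rewrite E3.
have key (x y : X) : dist (F x) m <= K -> dist (F y) m <= K -> dist x y <= tripod_const.
  move=> Hx Hy; apply: leq_trans (F_lower x y) _.
  rewrite /tripod_const leq_add2r leq_mul2l; apply/orP; right.
  by have := dist_triangle m (F x) (F y); rewrite (distC m); lia.
by exists a, b, c; split => //; split; apply: key.
Qed.

(** The tripod consists of [s] and geodesics from [x] and [y] to [o]. Its point on [s] is no closer
    to [o] than [x], so the nearby points on the two geodesics have descended by at most
    [tripod_const]; going from [x] to [y] through these two points costs three such constants. *)
Lemma level_component_diameter (o x y : X) s :
  dist o x = dist o y -> path adj x s -> last x s = y ->
  (forall z, z \in x :: s -> dist o x <= dist o z) ->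
  dist x y <= 3 * tripod_const.
Proof.
move=> Hxy Hs Hl Hz.
have [p2 [P2 L2 G2]] := geodesicP y o.
have [p3 [P3 L3 G3]] := geodesicP x o.
have [a [b [c [Ia Ib Ic [ab bc ac]]]]] := tripod Hs Hl P2 (esym L2) P3 (esym L3).
have := Hz _ Ia; have := G2 _ Ib; have := G3 _ Ic.
have := dist_triangle c x y; have := dist_triangle b c y.
have := dist_triangle c o a; have := dist_triangle b o a.
have := (distC y b, distC y o, distC x o, distC c o, distC c a, distC c b).
have := (distC b o, distC b a).
move=> [? ?] [[[[[? ?] ?] ?] ?] ?]; lia.
Qed.

(** The tripod point [a] on the geodesic from [u] to [v] lies in one half; for the end beyond the
    other half, being within [r] of [w] forces [N] plus the distances from [a] to [m] and to [w] to
    be at most [r] plus two tripod constants. *)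
Lemma almost_center N r (u v m w : X) : dist u m = N -> dist m v = N ->
  dist u v = 2 * N -> dist u w <= r -> dist v w <= r ->
  dist m w <= 2 * (r - N) + 6 * tripod_const.
Proof.
move=> um mv uv uw vw.
have [p1 [P1 L1 G1]] := geodesicP u m.
have [p1' [P1' L1' G1']] := geodesicP m v.
have [p2 [P2 L2 G2]] := geodesicP v w.
have [p3 [P3 L3 G3]] := geodesicP u w.
have Q : path adj u (p1 ++ p1') by rewrite cat_path P1 -L1.
have QL : last u (p1 ++ p1') = v by rewrite last_cat -L1.
have [a [b [c [Ia Ib Ic [ab bc ac]]]]] := tripod Q QL P2 (esym L2) P3 (esym L3).
have := G2 _ Ib; have := G3 _ Ic.
have Ha : dist u a + dist a m = N \/ dist m a + dist a v = N.
  move: Ia; rewrite -cat_cons mem_cat => /orP[/G1|H]; first by lia.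
  by right; rewrite -mv; apply: G1'; rewrite inE H orbT.
have := dist_triangle a u v; have := dist_triangle b a w; have := dist_triangle c a w.
have := dist_triangle a m w; have := dist_triangle b v a.
have := dist_triangle c u a.
have := (distC v a, distC v b, distC b a, distC m a, distC c a).
move=> [[[[? ?] ?] ?] ?]; lia.
Qed.

End QuasiTree.

(** * Partial graph isomorphisms between balls *)

Section LocalIsomorphism.

(* A partial isomorphism of vertex balls: [f] need not preserve adjacency of two
   vertices on the sphere of radius [n]. *)
Definition liso (X Y : graph) (n : nat) (x : X) (f : X -> Y) : Prop :=
  (forall u v, dist x u <= n -> dist x v <= n -> f u = f v -> u = v) /\
  (forall u, dist x u < n ->
     forall w, adj (f u) w <-> exists2 v, adj u v & f v = w).

Lemma liso_sub (X Y : graph) n m (x x' : X) (f : X -> Y) :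
  liso n x f -> dist x x' + m <= n -> liso m x' f.
Proof.
move=> [H1 H2] H; split => [u v Hu Hv|u Hu].
  by apply: H1; [have := dist_triangle x' x u | have := dist_triangle x' x v]; lia.
by apply: H2; have := dist_triangle x' x u; lia.
Qed.

Lemma liso_adj (X Y : graph) n (x : X) (f : X -> Y) u v :
  liso n x f -> dist x u < n -> adj u v -> adj (f u) (f v).
Proof. by move=> [_ H] Hu a; apply/H => //; exists v. Qed.

Lemma liso_dist_le (X Y : graph) n (x : X) (f : X -> Y) u :
  liso n x f -> dist x u <= n -> dist (f x) (f u) <= dist x u.
Proof.
move=> Hf; move E : (dist x u) => k.
elim: k u E => [|k IH] u E Hk; first by rewrite -(dist0_eq E) distxx.
have [|z [uz Ez]] := @lower_neighbor _ x u; first by rewrite E.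
have Ek : dist x z = k by lia.
have := IH _ Ek (ltnW Hk); have := @dist_adj _ (f x) (f z) (f u).
rewrite (liso_adj Hf) //; first by move=> /(_ isT); lia.
  by lia.
by rewrite adj_symmetric.
Qed.

(** A shortest walk from [f x] to [w] is lifted edge by edge, so the preimage is no farther from [x]
    than [w] is from [f x]. *)
Lemma liso_lift (X Y : graph) n (x : X) (f : X -> Y) w :
  liso n x f -> dist (f x) w <= n ->
  exists2 u, dist x u <= dist (f x) w & f u = w.
Proof.
move=> Hf; move E : (dist (f x) w) => k.
elim: k w E => [|k IH] w E Hk.
  by exists x; [rewrite distxx | apply: dist0_eq].
have [|z [wz Ez]] := @lower_neighbor _ (f x) w; first by rewrite E.
have Ek : dist (f x) z = k by lia.
have [u Hu Eu] := IH _ Ek (ltnW Hk); subst z.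
have [_ /(_ u)] := Hf.
have Hlt : dist x u < n by lia.
move=> /(_ Hlt w) []; rewrite adj_symmetric => /(_ wz) [v uv Ev] _.
by exists v => //; have := dist_adj x uv; lia.
Qed.

Lemma liso_dist_center (X Y : graph) n (x : X) (f : X -> Y) u :
  liso n x f -> dist x u <= n -> dist (f x) (f u) = dist x u.
Proof.
move=> Hf Hu; apply/eqP; rewrite eqn_leq (liso_dist_le Hf Hu) /=.
have H : dist (f x) (f u) <= n by apply: leq_trans (liso_dist_le Hf Hu) Hu.
have [v Hv Ev] := liso_lift Hf H.
have [inj _] := Hf; have E : v = u by apply: inj => //; apply: leq_trans Hv H.
by rewrite E in Hv.
Qed.

Lemma liso_dist (X Y : graph) n (x : X) (f : X -> Y) u v :
  liso n x f -> dist x u + dist u v <= n -> dist (f u) (f v) = dist u v.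
Proof. by move=> Hf H; apply: (liso_dist_center (liso_sub Hf H)). Qed.

Lemma liso_inverse (X Y : graph) n (x : X) (f : X -> Y) : liso n x f ->
  exists g : Y -> X, [/\ liso n (f x) g,
    forall u, dist x u <= n -> g (f u) = u &
    forall w, dist (f x) w <= n -> f (g w) = w].
Proof.
move=> Hf.
(* Outside the ball the inverse takes the arbitrary value [x]. *)
have /choice[g Hg] : forall w, exists u,
    dist (f x) w <= n -> dist x u <= n /\ f u = w.
  move=> w; case: (leqP (dist (f x) w) n) => H; last by exists x.
  by have [u Hu Eu] := liso_lift Hf H; exists u => _; split => //; apply: leq_trans H.
have [inj nbr] := Hf.
have fg w : dist (f x) w <= n -> f (g w) = w by move=> /Hg[].
have gf u : dist x u <= n -> g (f u) = u.
  move=> Hu; have [|H1 H2] := Hg (f u); first by rewrite (liso_dist_center Hf Hu).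
  exact: inj.
exists g; split => //; split => [u v Hu Hv E|w Hw v].
  by rewrite -(fg u) // -(fg v) // E.
have [Hu Eu] := Hg w (ltnW Hw).
have Hlt : dist x (g w) < n by rewrite -(liso_dist_center Hf Hu) Eu.
split.
  move=> a; exists (f v); first by rewrite -{1}Eu; apply: (liso_adj Hf Hlt a).
  by apply: gf; have := dist_adj x a; lia.
move=> [w' a <-]; move: a; rewrite -{1}Eu => /(nbr _ Hlt) [v' a Ev'].
by rewrite -Ev' gf //; have := dist_adj x a; lia.
Qed.

Lemma liso_comp (X Y Z : graph) n (x : X) (f : X -> Y) (g : Y -> Z) :
  liso n x f -> liso n (f x) g -> liso n x (g \o f).
Proof.
move=> Hf Hg; have [If Nf] := Hf; have [Ig Ng] := Hg; split => [u v Hu Hv|u Hu w] /=.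
  by move=> /Ig E; apply: If => //; apply: E; rewrite (liso_dist_center Hf).
have Hfu : dist (f x) (f u) < n by rewrite (liso_dist_center Hf) // ltnW.
rewrite Ng //; split => [[y /(Nf _ Hu) [v a <-] <-]|[v a <-]]; first by exists v.
by exists (f v) => //; apply: (liso_adj Hf Hu a).
Qed.

Lemma liso_ext (X Y : graph) n (x : X) (f g : X -> Y) :
  liso n x f -> (forall u, dist x u <= n -> g u = f u) -> liso n x g.
Proof.
move=> [H1 H2] E; split => [u v Hu Hv|u Hu w].
  by rewrite !E //; apply: H1.
rewrite E ?(ltnW Hu) // H2 //.
have Hv v : adj u v -> dist x v <= n by move=> /(dist_adj x); lia.
by split => -[v a <-]; exists v => //; rewrite E // Hv.
Qed.

End LocalIsomorphism.

(** * Extending partial isomorphisms to arbitrary radius *)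

Section Extension.
Variable X : graph.

(* A map that is [liso] at every radius is an automorphism of [X]. *)
Definition finitely_many_orbits : Prop :=
  exists s : seq X, forall x : X, exists2 x0, x0 \in s &
    exists f : X -> X, f x0 = x /\ forall n, liso n x0 f.

Lemma finite_seqs (A : eqType) (s : seq A) n :
  exists K : seq (seq A), forall t, size t = n -> {subset t <= s} -> t \in K.
Proof.
elim: n => [|n [K HK]].
  by exists [:: [::]] => t /size0nil->.
exists [seq a :: t | a <- s, t <- K] => -[|a t] //= [Ht] Hs.
apply: allpairs_f; first by apply: Hs; rewrite mem_head.
by apply: HK => // z zt; apply: Hs; rewrite inE zt orbT.
Qed.

Lemma uniform_bound (A : eqType) (s : seq A) (P : A -> nat -> Prop) :
  (forall a, a \in s -> exists n, forall m, n <= m -> P a m) ->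
  exists n, forall a m, a \in s -> n <= m -> P a m.
Proof.
elim: s => [|a s IH] H; first by exists 0.
have [|n Hn] := IH; first by move=> b bs; apply: H; rewrite inE bs orbT.
have [k Hk] := H a (mem_head _ _).
exists (maxn n k) => b m; rewrite inE geq_max => /orP[/eqP->|bs] /andP[? ?].
  exact: Hk.
exact: Hn.
Qed.

(** There are finitely many maps from the [k]-ball of [x0] to that of [x1]. Each one that is not a
    restriction at some radius is not one at any larger radius either; [rho] is beyond all these
    radii of failure. *)
Lemma extension_between (k : nat) (x0 x1 : X) : exists rho, forall m, rho <= m ->
  forall f : X -> X, liso m x0 f -> f x0 = x1 -> forall n,
  exists g : X -> X, liso n x0 g /\ forall u, dist x0 u <= k -> g u = f u.
Proof.
have [e He] := (finite_seqP _).1 (finite_ball x0 k).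
have [b Hb] := (finite_seqP _).1 (finite_ball x1 k).
have memE u : dist x0 u <= k <-> u \in e.
  by split => [H|H]; [have : [set` e] u by rewrite -He | have : [set` e] u by []; rewrite -He].
have [K HK] := finite_seqs b (size e).
(* A map on the [k]-ball is recorded as the list [key] of its values along the enumeration [e]. *)
pose good key n := exists2 g : X -> X, liso n x0 g & map g e = key.
have [rho Hrho] : exists rho, forall key m, key \in K -> rho <= m ->
    good key m -> forall n, good key n.
  apply: uniform_bound => key _.
  have [H|/existsNP[n Hn]] := pselect (forall n, good key n).
    by exists 0 => *; apply: H.
  exists n => m nm [g Hg Eg]; case: Hn; exists g => //.
  by apply: (liso_sub Hg); rewrite distxx.
exists (maxn rho k) => m; rewrite geq_max => /andP[rm km] f Hf Ef n.
have [||g Hg Eg] := Hrho (map f e) m _ rm _ n.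
- apply: HK; first by rewrite size_map.
  move=> _ /mapP[u /memE Hu ->].
  have : [set y | dist x1 y <= k] (f u).
    by rewrite /= -Ef (liso_dist_center Hf) //; apply: leq_trans km.
  by rewrite Hb.
- by exists f.
exists g; split=> // u /memE ue.
by have /eq_in_map := Eg; apply.
Qed.

(** Conjugating by automorphisms moves [x] and [f x] to orbit representatives, and finitely many
    pairs of these need only one common [rho]. *)
Lemma extension (k : nat) : finitely_many_orbits ->
  exists2 rho, k <= rho & forall n (x : X) (f : X -> X), liso rho x f ->
  exists g : X -> X, liso n x g /\ forall u, dist x u <= k -> g u = f u.
Proof.
move=> [s Hs].
have [rho Hrho] : exists rho, forall x0 m, x0 \in s -> rho <= m ->
    forall x1, x1 \in s -> forall f : X -> X, liso m x0 f -> f x0 = x1 -> forall n,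
    exists g : X -> X, liso n x0 g /\ forall u, dist x0 u <= k -> g u = f u.
  apply: uniform_bound => x0 _.
  have [r Hr] : exists r, forall x1 m, x1 \in s -> r <= m ->
    forall f : X -> X, liso m x0 f -> f x0 = x1 -> forall n,
    exists g : X -> X, liso n x0 g /\ forall u, dist x0 u <= k -> g u = f u.
    by apply: uniform_bound => x1 _; apply: extension_between.
  by exists r => m rm x1 x1s; apply: Hr.
exists (maxn rho k) => [|n x f Hf']; first exact: leq_maxr.
have Hf : liso rho x f by apply: (liso_sub Hf'); rewrite distxx leq_maxl.
have [x0 x0s [a [Ea Ha]]] := Hs x.
have [x1 x1s [b [Eb Hb]]] := Hs (f x).
pose N := maxn n (maxn k rho).
have [nN kN rN] : [/\ n <= N, k <= N & rho <= N] by rewrite /N; split; lia.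
have [b' [Hb' b'b bb']] := liso_inverse (Hb N).
have [a' [Ha' a'a aa']] := liso_inverse (Ha N).
rewrite Ea in Ha' aa'; rewrite Eb in Hb' bb'.
have le0 m M (y z : X) (h : X -> X) : m <= M -> liso M y h -> liso m y h.
  by move=> mM /liso_sub; apply; rewrite distxx.
have a'x : a' x = x0 by rewrite -Ea a'a // distxx.
have b'f : b' (f x) = x1 by rewrite -Eb b'b // distxx.
have [||g0 [Hg0 Eg0]] := Hrho x0 rho x0s (leqnn _) x1 x1s (b' \o f \o a) _ _ N.
- apply: liso_comp; first exact: Ha.
  rewrite Ea; apply: liso_comp => //.
  by apply: le0 Hb' => //.
- by rewrite /= Ea.
have g0x : g0 x0 = x1 by rewrite Eg0 ?distxx //= Ea.
exists (b \o g0 \o a'); split.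
  apply: liso_comp; first by apply: le0 Ha'.
  rewrite a'x; apply: liso_comp; first by apply: le0 Hg0.
  by rewrite g0x; apply: Hb.
move=> u Hu /=.
have Hu' : dist x u <= N by apply: leq_trans kN.
rewrite Eg0 /=; last by rewrite -a'x (liso_dist_center Ha').
rewrite aa' // bb' // (liso_dist_center Hf') //.
by rewrite leq_max Hu orbT.
Qed.

End Extension.

(** * Gluing partial isomorphisms along the components of the levels *)

Section Gluing.
Variables (X Y : graph) (D rho : nat).
Hypothesis level_diam : forall (o x y : X) s,
  dist o x = dist o y -> path adj x s -> last x s = y ->
  (forall z, z \in x :: s -> dist o x <= dist o z) -> dist x y <= D.
Hypothesis rho_ge : D.+1 <= rho.
Hypothesis ext : forall n (x : X) (f : X -> X), liso rho x f ->
  exists g : X -> X, liso n x g /\ forall u, dist x u <= D.+1 -> g u = f u.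

(** A chart of radius [N] at one center is still of radius [rho] at a center [D.+1] away, which is
    what an extension requires. *)
Let N := rho + D.+1.

Hypothesis locally_X : forall y : Y, exists psi : Y -> X, liso N y psi.

(** Read through a chart [psi] of [Y] at [phi c], [phi] becomes a partial isomorphism of [X]; it is
    extended there and carried back by the inverse of [psi]. *)
Lemma transfer (phi : X -> Y) (c : X) : liso rho c phi ->
  exists chi : X -> Y, liso N c chi /\ forall u, dist c u <= D.+1 -> chi u = phi u.
Proof.
move=> Hphi; have [psi Hpsi] := locally_X (phi c).
have rN : rho <= N by rewrite /N leq_addr.
have [psi' [Hpsi' K1 K2]] := liso_inverse Hpsi.
have [|g [Hg Eg]] := @ext N c (psi \o phi).
  by apply: liso_comp => //; apply: (liso_sub Hpsi); rewrite distxx.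
exists (psi' \o g); split.
  by apply: liso_comp => //; rewrite Eg ?distxx.
move=> u Hu /=; rewrite Eg //= K1 //.
have Hu' : dist c u <= rho by apply: leq_trans rho_ge.
by apply: leq_trans rN; rewrite (liso_dist_center Hphi).
Qed.

Section Base.
Variables (o : X) (chi0 : X -> Y).
Hypothesis chi0P : liso N o chi0.

Definition same_piece (x y : X) : Prop := dist o x = dist o y /\
  exists s, [/\ path adj x s, last x s = y &
    forall z, z \in x :: s -> dist o x <= dist o z].

Lemma same_piece_refl x : same_piece x x.
Proof. by split => //; exists [::]; split => // z; rewrite inE => /eqP->. Qed.

Lemma same_piece_sym x y : same_piece x y -> same_piece y x.
Proof.
move=> [E [s [Hs Hl Hz]]]; split => //.
have [r [Hr1 Hr2 Hr3]] := rev_walk Hs; rewrite Hl in Hr1 Hr2 Hr3.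
by exists r; split => // z; rewrite Hr3 -E; apply: Hz.
Qed.

Lemma same_piece_trans x y z : same_piece x y -> same_piece y z -> same_piece x z.
Proof.
move=> [E [s [Hs Hl Hz]]] [E' [s' [Hs' Hl' Hz']]]; split; first by rewrite E.
exists (s ++ s'); split; rewrite ?cat_path ?last_cat ?Hl ?Hs //.
move=> w; rewrite -cat_cons mem_cat => /orP[/Hz//|H].
by rewrite E; apply: Hz'; rewrite inE H orbT.
Qed.

Lemma same_piece_dist x y : same_piece x y -> dist x y <= D.
Proof. by move=> [E [s [Hs Hl Hz]]]; apply: level_diam Hs Hl Hz. Qed.

(** The choice depends on the predicate alone, so vertices of one piece get equal representatives.
    The default [o] is harmless: pieces are nonempty. *)
Definition choose_in (P : X -> Prop) : X :=
  if pselect (exists y, P y) is left e then sval (cid e) else o.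

Definition rep (x : X) : X := choose_in (same_piece x).

Lemma repP x : same_piece x (rep x).
Proof.
rewrite /rep /choose_in; case: pselect => [e|[]]; first exact: (svalP (cid e)).
by exists x; apply: same_piece_refl.
Qed.

Lemma rep_eq x y : same_piece x y -> rep x = rep y.
Proof.
move=> xy; congr choose_in; apply/funext => z; apply/propext; split => H.
  exact: same_piece_trans (same_piece_sym xy) H.
exact: same_piece_trans xy H.
Qed.

Lemma lower_ex : exists lower : X -> X, forall z, 0 < dist o z ->
  adj z (lower z) /\ (dist o (lower z)).+1 = dist o z.
Proof.
have /choice[lower H] : forall z, exists w,
    0 < dist o z -> adj z w /\ (dist o w).+1 = dist o z.
  move=> z; case: (posnP (dist o z)) => [E|/lower_neighbor[w Hw]].
    by exists z; rewrite E.
  by exists w.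
by exists lower.
Qed.

Let lower : X -> X := sval (cid lower_ex).
Let lowerP z : 0 < dist o z -> adj z (lower z) /\ (dist o (lower z)).+1 = dist o z.
Proof. exact: (svalP (cid lower_ex)). Qed.

Lemma next_ex : exists next : (X -> Y) * X -> X -> Y, forall pc, liso rho pc.2 pc.1 ->
  liso N pc.2 (next pc) /\ forall u, dist pc.2 u <= D.+1 -> next pc u = pc.1 u.
Proof.
have /choice[next H] : forall pc : (X -> Y) * X, exists chi : X -> Y,
    liso rho pc.2 pc.1 ->
    liso N pc.2 chi /\ forall u, dist pc.2 u <= D.+1 -> chi u = pc.1 u.
  move=> [phi c] /=.
  have [H|H] := pselect (liso rho c phi); last by exists phi.
  by have [chi Hchi] := transfer H; exists chi.
by exists next.
Qed.

Let next := sval (cid next_ex).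
Let nextP pc : liso rho pc.2 pc.1 ->
  liso N pc.2 (next pc) /\ forall u, dist pc.2 u <= D.+1 -> next pc u = pc.1 u.
Proof. exact: (svalP (cid next_ex)). Qed.

(** Recursion on the level: [n] is meant to be [dist o c], and the parent piece, that of a lower
    neighbor, is one level down. Each chart comes by [transfer] from that of the parent's
    representative. *)
Fixpoint chart (n : nat) (c : X) : X -> Y :=
  if n is n'.+1 then next (chart n' (rep (lower c)), c) else chi0.

Lemma parent_dist c : 0 < dist o c -> dist (rep (lower c)) c <= D.+1.
Proof.
move=> /lowerP[a E].
have := same_piece_dist (same_piece_sym (repP (lower c))).
by have := dist_triangle (lower c) (rep (lower c)) c; rewrite (distC (lower c) c) (adj_dist a); lia.
Qed.

Lemma chart_liso n c : dist o c = n -> liso N c (chart n c).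
Proof.
elim: n c => [|n IH] c E /=; first by rewrite -(dist0_eq E).
have [|a El] := @lowerP c; first by rewrite E.
have [Er _] := repP (lower c).
have := @nextP (chart n (rep (lower c)), c); case => //=.
apply: (liso_sub (IH (rep (lower c)) _)); first by lia.
by have := @parent_dist c; rewrite /N; lia.
Qed.

Lemma chart_parent n c u : dist o c = n.+1 -> dist c u <= D.+1 ->
  chart n.+1 c u = chart n (rep (lower c)) u.
Proof.
move=> E Hu /=.
have [|a El] := @lowerP c; first by rewrite E.
have [Er _] := repP (lower c).
have := @nextP (chart n (rep (lower c)), c); case => //=; last by move=> _; apply.
apply: (liso_sub (chart_liso (n := n) _)); first by lia.
by have := @parent_dist c; rewrite /N; lia.
Qed.

Definition glued (v : X) : Y := chart (dist o v) (rep v) v.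

Lemma same_piece_adj u v : adj u v -> dist o u = dist o v -> same_piece u v.
Proof.
move=> a E; split => //; exists [:: v]; split; rewrite /= ?a //.
by move=> z; rewrite !inE => /orP[] /eqP->; rewrite ?E.
Qed.

(** This makes the pieces a tree: all lower neighbors of a piece lie in one piece. The walk from [v]
    up to [u], through the piece to [c] and down to [lower c] never goes below the level of [v]. *)
Lemma lower_same_piece c u v : same_piece c u -> adj u v ->
  dist o u = (dist o v).+1 -> same_piece v (lower c).
Proof.
move=> /same_piece_sym [E [s [Hs Hl Hz]]] uv Ev.
have [|a El] := @lowerP c; first by lia.
split; first by lia.
exists (u :: rcons s (lower c)); split.
- by rewrite /= adj_symmetric uv rcons_path Hs Hl.
- by rewrite /= last_rcons.
move=> z; rewrite inE => /orP[/eqP->//|].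
rewrite -rcons_cons mem_rcons inE => /orP[/eqP->|/Hz]; lia.
Qed.

Lemma chart_parent_edge u v : adj u v -> dist o u = (dist o v).+1 ->
  forall w, dist (rep u) w <= D.+1 ->
  chart (dist o u) (rep u) w = chart (dist o v) (rep v) w.
Proof.
move=> uv E w Hw; have [Er _] := repP u.
rewrite E chart_parent //; last by lia.
congr chart.
exact/esym/rep_eq/(lower_same_piece (same_piece_sym (repP u)) uv E).
Qed.

(** Adjacent vertices lie in one piece or in a piece and its parent. In the latter case the two
    charts agree within [D.+1] of the representative of the upper piece, and both vertices are that
    close to it. *)
Lemma glued_adj u v : adj u v -> glued u = chart (dist o v) (rep v) u.
Proof.
move=> uv; rewrite /glued.
have Hu := same_piece_dist (same_piece_sym (repP u)).
have Hv := same_piece_dist (same_piece_sym (repP v)).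
have H1 := dist_adj o uv; have vu : adj v u by rewrite adj_symmetric.
have H2 := dist_adj o vu; have H3 := dist_adj (rep v) vu.
case: (ltngtP (dist o u) (dist o v)) => H.
- by apply/esym/chart_parent_edge => //; lia.
- by apply: chart_parent_edge => //; lia.
- by rewrite H (rep_eq (same_piece_adj uv H)).
Qed.

Lemma glued_liso v : liso 1 v glued.
Proof.
have Er := (repP v).1.
apply: (@liso_ext _ _ _ _ (chart (dist o v) (rep v))).
  apply: (liso_sub (chart_liso (esym Er))).
  by have := same_piece_dist (same_piece_sym (repP v)); rewrite /N; lia.
move=> u; rewrite leq_eqVlt => /orP[/eqP|].
  by move=> /dist1_adj; rewrite adj_symmetric => /glued_adj.
by rewrite ltnS leqn0 => /eqP/dist0_eq <-.
Qed.

End Base.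

(** Surjectivity comes from lifting walks of the connected graph [Y]. *)
Lemma covering_of_liso1 (f : X -> Y) : (forall v, liso 1 v f) -> is_covering f.
Proof.
move=> Hf; split.
  move=> y _; have [x0] := graph_nonempty X.
  have [p] := graph_connected (f x0) y.
  elim: p x0 => [|b p IH] x0 /=; first by move=> _ ->; exists x0.
  move=> /andP[a Hp] El.
  have [_ /(_ x0)] := Hf x0; rewrite distxx => /(_ isT b) [/(_ a) [v _ Ev] _].
  by apply: (IH v); rewrite Ev.
move=> x; have [inj /(_ x)] := Hf x; rewrite distxx => /(_ isT) nbr; split.
- by move=> z /= a; apply/nbr; exists z.
- by move=> u v /set_mem /= xu /set_mem /= xv; apply: inj; rewrite adj_dist.
- by move=> w /= /nbr[v a E]; exists v.
Qed.

Lemma covered_by_gluing : Defs.covered_by Y X.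
Proof.
have [y0] := graph_nonempty Y; have [psi Hpsi] := locally_X y0.
have [chi [Hchi _ _]] := liso_inverse Hpsi.
by exists (glued (psi y0) chi); apply: covering_of_liso1 => v; apply: glued_liso.
Qed.

End Gluing.

Local Open Scope ring_scope.

(** * The metric realization *)

Section Metric.
Variables (R : realType) (X : graph).
Implicit Types (u v w : X) (p q : X -> R) (A : set (X -> R)).

Lemma edge_pointl u v (t : R) : adj u v -> edge_point u v t u = 1 - t.
Proof.
move=> /adj_neq/eqP/negbTE a.
by rewrite /edge_point eqxx a mulr1 mulr0 addr0.
Qed.

Lemma edge_pointr u v (t : R) : adj u v -> edge_point u v t v = t.
Proof.
move=> /adj_neq/eqP a; rewrite eq_sym in a; move/negbTE: a => a.
by rewrite /edge_point eqxx a mulr1 mulr0 add0r.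
Qed.

Lemma edge_point_out u v (t : R) w : w <> u -> w <> v -> edge_point u v t w = 0.
Proof.
move=> /eqP/negbTE H1 /eqP/negbTE H2.
by rewrite /edge_point H1 H2 !mulr0 addr0.
Qed.

Lemma edge_pointC u v (t : R) : edge_point u v t = edge_point v u (1 - t).
Proof. by apply/funext => w; rewrite /edge_point subKr addrC. Qed.

Lemma edge_point0 u v : edge_point u v (0 : R) = vertex_point R u.
Proof.
by apply/funext => w; rewrite /edge_point /vertex_point subr0 mul1r mul0r addr0.
Qed.

Lemma edge_point1 u v : edge_point u v (1 : R) = vertex_point R v.
Proof. by rewrite edge_pointC subrr edge_point0. Qed.

Lemma vertex_point_inj u v : vertex_point R u = vertex_point R v -> u = v.
Proof.
move=> /(congr1 (fun f => f u)); rewrite /vertex_point eqxx.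
by case: eqP => // _ /eqP; rewrite oner_eq0.
Qed.

Lemma realization_vertex u : realization (vertex_point R u).
Proof. by left; exists u. Qed.

Lemma realization_edge u v (t : R) : adj u v -> 0 <= t -> t <= 1 ->
  realization (edge_point u v t).
Proof. by move=> a t0 t1; right; exists u, v, t; split => //; rewrite t0 t1. Qed.

(* The distance from the vertex [w]: a shortest path to [q] enters the edge of
   [q] through a vertex of the support of [q]. *)
Definition vdist w q : R :=
  inf [set c | exists2 v, 0 < q v & c = (dist w v)%:R + (1 - q v)].

Lemma inf_min (S : set R) m : S m -> lbound S m -> inf S = m.
Proof.
move=> Sm lb; apply/eqP; rewrite eq_le; apply/andP; split.
  by apply: ge_inf => //; exists m.
by apply: lb_le_inf => //; exists m.
Qed.

Lemma vdist_edge w u v (t : R) : adj u v -> 0 <= t -> t <= 1 ->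
  vdist w (edge_point u v t) =
  Num.min ((dist w u)%:R + t) ((dist w v)%:R + (1 - t)).
Proof.
move=> uv t0 t1; apply: inf_min.
  have vu : adj v u by rewrite adj_symmetric.
  have D1 : (dist w u)%:R <= (dist w v)%:R + 1 :> R.
    by rewrite natr1 ler_nat; apply: dist_adj.
  have D2 : (dist w v)%:R <= (dist w u)%:R + 1 :> R.
    by rewrite natr1 ler_nat; apply: dist_adj.
  case: (leP ((dist w u)%:R + t) ((dist w v)%:R + (1 - t))) => H.
    (* At [t = 1] the vertex [u] is no longer in the support, but then both terms of the minimum are
       equal and [v] attains it. The case [t = 0] below is symmetric. *)
    case: (ltP t 1) => Ht.
      by exists u; rewrite edge_pointl //; lra.
    by exists v; rewrite edge_pointr //; lra.
  case: (ltP 0 t) => Ht.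
    by exists v; rewrite edge_pointr //; lra.
  by exists u; rewrite edge_pointl //; lra.
move=> c [z Hz ->]; rewrite ge_min.
have [->|zu] := eqVneq z u; first by rewrite edge_pointl // subKr lexx.
have [->|zv] := eqVneq z v; first by rewrite edge_pointr // lexx orbT.
by move: Hz; rewrite edge_point_out ?ltxx //; apply/eqP.
Qed.

Lemma vdist_vertex w u : vdist w (vertex_point R u) = (dist w u)%:R.
Proof.
apply: inf_min => [|c [v]].
  by exists u; rewrite /vertex_point eqxx // subrr addr0.
rewrite /vertex_point; case: eqP => [->|]; first by rewrite subrr addr0 => _ ->.
by rewrite ltxx.
Qed.

Lemma vdist_edge_lip w u v (s t : R) : adj u v -> 0 <= s -> s <= t -> t <= 1 ->
  vdist w (edge_point u v s) <= vdist w (edge_point u v t) + (t - s) /\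
  vdist w (edge_point u v t) <= vdist w (edge_point u v s) + (t - s).
Proof.
move=> uv s0 st t1; rewrite !vdist_edge //; try lra.
case: (leP ((dist w u)%:R + s) ((dist w v)%:R + (1 - s))) => ?;
case: (leP ((dist w u)%:R + t) ((dist w v)%:R + (1 - t))) => ?; split; lra.
Qed.

Lemma path_length_ge0 A p q l : path_length A p q l -> 0 <= l.
Proof. by elim=> // *; lra. Qed.

(** The explicit function [vdist w] is 1-Lipschitz along paths; this is the lower bound on lengths
    that identifies it with the distance from [w]. *)
Lemma vdist_path w A p q l : path_length A p q l ->
  vdist w p <= vdist w q + l /\ vdist w q <= vdist w p + l.
Proof.
elim=> [p0 _|u v s t {}q {}l uv s0 st t1 _ _ [H1 H2]]; first by rewrite addr0.
by have [H3 H4] := vdist_edge_lip w uv s0 st t1; split; lra.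
Qed.

Lemma path_length_sub A B p q l : (forall z, A z -> B z) ->
  path_length A p q l -> path_length B p q l.
Proof.
move=> AB; elim=> [p0 /AB|u v s t {}q {}l uv s0 st t1 H _ IH].
  exact: path_length_nil.
by apply: path_length_cons => // r /H/AB.
Qed.

Lemma path_length_cat A p q z l m : path_length A p q l -> path_length A q z m ->
  path_length A p z (l + m).
Proof.
move=> H; elim: H m => [p0 _|u v s t {}q {}l uv s0 st t1 H _ IH] m.
  by rewrite add0r.
by move=> /IH H'; rewrite -addrA; apply: path_length_cons.
Qed.

Lemma path_length_edge A u v (s t : R) : adj u v -> 0 <= s -> s <= t -> t <= 1 ->
  (forall r, s <= r <= t -> A (edge_point u v r)) ->
  path_length A (edge_point u v s) (edge_point u v t) (t - s).
Proof.
move=> uv s0 st t1 H; rewrite -[t - s]addr0; apply: path_length_cons => //.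
by apply: path_length_nil; apply: H; rewrite st lexx.
Qed.

Lemma path_length_edgeV A u v (s t : R) : adj u v -> 0 <= s -> s <= t -> t <= 1 ->
  (forall r, s <= r <= t -> A (edge_point u v r)) ->
  path_length A (edge_point u v t) (edge_point u v s) (t - s).
Proof.
move=> uv s0 st t1 H; rewrite edge_pointC (edge_pointC u v s).
have -> : t - s = (1 - s) - (1 - t) by lra.
apply: path_length_edge; try lra; first by rewrite adj_symmetric.
by move=> r Hr; rewrite -[r](subKr 1) -edge_pointC; apply: H; lra.
Qed.

Lemma path_length_rev A p q l : path_length A p q l -> path_length A q p l.
Proof.
elim=> [p0|u v s t {}q {}l uv s0 st t1 H _ IH]; first exact: path_length_nil.
by rewrite addrC; apply: path_length_cat IH _; apply: path_length_edgeV.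
Qed.

Lemma path_length_walk x (s : seq X) : path adj x s ->
  path_length (@realization R X) (vertex_point R x) (vertex_point R (last x s))
    (size s)%:R.
Proof.
elim: s x => [|y s IH] x /=; first by move=> _; apply: path_length_nil; left; exists x.
move=> /andP[xy /IH H]; rewrite -natr1 addrC.
apply: path_length_cat H.
rewrite -(edge_point0 x y) -(edge_point1 x y) -[X in path_length _ _ _ X](subr0 1).
by apply: path_length_edge => // r /andP[? ?]; apply: realization_edge.
Qed.

Lemma vdist_attained w q : realization q ->
  path_length (@realization R X) (vertex_point R w) q (vdist w q).
Proof.
have Hv u : path_length (@realization R X) (vertex_point R w) (vertex_point R u)
    (dist w u)%:R.
  by have [s Hs [-> <-]] := distP w u; apply: path_length_walk.
move=> [[x ->]|[u [v [t [uv /andP[t0 t1] ->]]]]]; first by rewrite vdist_vertex.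
rewrite vdist_edge //; case: leP => _.
  apply: path_length_cat (Hv u) _; rewrite -(edge_point0 u v).
  rewrite -[X in path_length _ _ _ X]subr0; apply: path_length_edge => // r Hr.
  by apply: realization_edge => //; lra.
apply: path_length_cat (Hv v) _; rewrite -(edge_point1 u v).
apply: path_length_edgeV => // r Hr.
by apply: realization_edge => //; lra.
Qed.

Definition gdist p q : R := inf (path_length (@realization R X) p q).

Lemma connected_points p q : realization p -> realization q ->
  exists l, path_length (@realization R X) p q l.
Proof.
move=> Hp Hq; have [x] := graph_nonempty X.
exists (vdist x p + vdist x q); apply: path_length_cat (vdist_attained x Hq).
exact/path_length_rev/vdist_attained.
Qed.

Lemma gdist_le p q l : path_length (@realization R X) p q l -> gdist p q <= l.
Proof.
by move=> H; apply: ge_inf => //; exists 0 => m; apply: path_length_ge0.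
Qed.

Lemma le_gdist p q c : realization p -> realization q ->
  (forall l, path_length (@realization R X) p q l -> c <= l) -> c <= gdist p q.
Proof.
by move=> Hp Hq H; apply: lb_le_inf => [|l /H//]; apply: connected_points.
Qed.

Lemma gdist_approx p q e : realization p -> realization q -> gdist p q < e ->
  exists2 l, path_length (@realization R X) p q l & l < e.
Proof.
by move=> Hp Hq; apply: inf_lt; apply: connected_points.
Qed.

Lemma geodesic_distE p q : realization p -> realization q ->
  geodesic_dist p q = (gdist p q)%:E.
Proof.
move=> Hp Hq; rewrite /geodesic_dist /intrinsic_dist ereal_inf_EFin //.
  by exists 0 => l; apply: path_length_ge0.
exact: connected_points.
Qed.

Lemma gdist_ge0 p q : realization p -> realization q -> 0 <= gdist p q.
Proof. by move=> Hp Hq; apply: le_gdist => // l; apply: path_length_ge0. Qed.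

Lemma gdistC p q : gdist p q = gdist q p.
Proof.
congr inf; apply/funext => l; apply/propext; split; exact: path_length_rev.
Qed.

Lemma gdist_triangle q p z : realization p -> realization q -> realization z ->
  gdist p z <= gdist p q + gdist q z.
Proof.
move=> Hp Hq Hz; rewrite -lerBlDr; apply: le_gdist => // l Hl.
rewrite lerBlDr -lerBlDl; apply: le_gdist => // m Hm.
by rewrite lerBlDl; apply: gdist_le; apply: path_length_cat Hm.
Qed.

Lemma gdist_vertex w q : realization q -> gdist (vertex_point R w) q = vdist w q.
Proof.
move=> Hq; apply/eqP; rewrite eq_le; apply/andP; split.
  exact/gdist_le/vdist_attained.
apply: le_gdist => // [|l Hl]; first exact: realization_vertex.
by have [_] := vdist_path w Hl; rewrite vdist_vertex distxx add0r.
Qed.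

Lemma gdist_vertices u v : gdist (vertex_point R u) (vertex_point R v) = (dist u v)%:R.
Proof. by rewrite gdist_vertex ?vdist_vertex //; apply: realization_vertex. Qed.

Lemma gdistxx p : realization p -> gdist p p = 0.
Proof.
move=> Hp; apply/eqP; rewrite eq_le gdist_ge0 // andbT.
by apply: gdist_le; apply: path_length_nil.
Qed.

Lemma vdist_lip w p q : realization p -> realization q ->
  vdist w q <= vdist w p + gdist p q.
Proof.
move=> Hp Hq; rewrite -lerBlDl; apply: le_gdist => // l /(vdist_path w)[_].
by rewrite lerBlDl.
Qed.

Lemma gdist_edge u v (s t : R) : adj u v -> 0 <= s <= 1 -> 0 <= t <= 1 ->
  gdist (edge_point u v s) (edge_point u v t) <= `|s - t|.
Proof.
move=> uv /andP[s0 s1] /andP[t0 t1]; case: (leP s t) => st.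
  rewrite ler0_norm ?subr_le0 // opprB; apply: gdist_le.
  by apply: path_length_edge => // r Hr; apply: realization_edge => //; lra.
rewrite gtr0_norm ?subr_gt0 //; apply: gdist_le.
by apply: path_length_edgeV => // [|r Hr]; [lra | apply: realization_edge => //; lra].
Qed.

Lemma near_vertex q : realization q -> exists w, vdist w q <= 1.
Proof.
move=> [[x ->]|[u [v [t [uv /andP[t0 t1] ->]]]]].
  by exists x; rewrite vdist_vertex distxx.
by exists u; rewrite vdist_edge // distxx ge_min; lra.
Qed.

Lemma graph_ballE x r q : graph_ball x r q <-> realization q /\ vdist x q <= r.
Proof.
rewrite /graph_ball /=; have Hx := realization_vertex x.
by split=> -[Hq]; rewrite geodesic_distE // gdist_vertex // lee_fin.
Qed.

(** A path cannot get farther from [x] than its starting distance plus its length. Hence intrinsic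
    distances in a ball are ambient ones from the center and well inside the ball. *)
Lemma path_stays x r p q l : path_length (@realization R X) p q l ->
  vdist x p + l <= r -> path_length (graph_ball x r) p q l.
Proof.
elim=> [p0 Hp0|u v s t {}q {}l uv s0 st t1 H Hpath IH] Hr.
  by apply: path_length_nil; apply/graph_ballE; split => //; lra.
have l0 := path_length_ge0 Hpath.
have [_ Hst] := vdist_edge_lip x uv s0 st t1.
apply: path_length_cons => //; last by apply: IH; lra.
move=> a /andP[sa ta]; apply/graph_ballE; split; first by apply: H; rewrite sa ta.
have a1 : a <= 1 by lra.
by have [_ Hsa] := vdist_edge_lip x uv s0 sa a1; lra.
Qed.

Lemma intrinsic_ge A p q : A `<=` @realization R X ->
  (geodesic_dist p q <= intrinsic_dist A p q)%E.
Proof.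
move=> AR; apply: le_ereal_inf => _ [l Hl <-]; exists l => //.
exact: path_length_sub Hl.
Qed.

Lemma intrinsic_center x r q : graph_ball x r q ->
  intrinsic_dist (graph_ball x r) (vertex_point R x) q = (vdist x q)%:E.
Proof.
move=> /graph_ballE[Hq Hr]; apply/eqP; rewrite eq_le; apply/andP; split.
  apply: ereal_inf_lbound; exists (vdist x q) => //.
  by apply: path_stays; [apply: vdist_attained | rewrite vdist_vertex distxx add0r].
rewrite -gdist_vertex // -geodesic_distE //; last exact: realization_vertex.
by apply: intrinsic_ge => z [].
Qed.

(** The strict inequality leaves room for paths slightly longer than the infimum. *)
Lemma intrinsic_inner x r p q : realization p -> realization q ->
  vdist x p + gdist p q < r ->
  intrinsic_dist (graph_ball x r) p q = (gdist p q)%:E.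
Proof.
move=> Hp Hq Hr; apply/eqP; rewrite eq_le; apply/andP; split; last first.
  by rewrite -geodesic_distE //; apply: intrinsic_ge => z [].
apply/lee_addgt0Pr => e e0.
have [|l Hl He] := @gdist_approx p q (Num.min (gdist p q + e) (r - vdist x p)) Hp Hq.
  by rewrite lt_min; apply/andP; split; lra.
move: He; rewrite lt_min => /andP[He Hr'].
apply: (@le_trans _ _ l%:E); last by rewrite -EFinD lee_fin ltW.
by apply: ereal_inf_lbound; exists l => //; apply: path_stays => //; lra.
Qed.

End Metric.

(** * Local isometries between metric balls *)

Section LocalIsometry.
Variable R : realType.

Definition point_ball (X : graph) (p : X -> R) (m : R) : set (X -> R) :=
  [set z | realization z /\ gdist p z <= m].

(** The centers are arbitrary points, as isometries of balls need not respect vertices. Distances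
    are taken in the whole graph, so that the notion restricts to smaller balls. *)
Definition lisom (X Y : graph) (m : R) (p : X -> R) (q : Y -> R)
    (g : (X -> R) -> Y -> R) : Prop :=
  [/\ g p = q,
      forall z, point_ball p m z -> point_ball q m (g z),
      forall z z', point_ball p m z -> point_ball p m z' ->
        gdist (g z) (g z') = gdist z z',
      forall z z', point_ball p m z -> point_ball p m z' -> g z = g z' -> z = z' &
      forall w, point_ball q m w -> exists2 z, point_ball p m z & g z = w].

(** In the interior of an edge the distance from a vertex is never an integer. *)
Lemma gdist1_vertex (X : graph) (w : X) (q : X -> R) : realization q ->
  gdist (vertex_point R w) q = 1 -> exists2 u, adj w u & q = vertex_point R u.
Proof.
move=> Hq; rewrite gdist_vertex //.
have Hv u : (dist w u)%:R = 1 :> R -> adj w u.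
  by move=> /eqP; rewrite -[X in _ == X]/(1%:R) eqr_nat => /eqP/dist1_adj.
move: Hq => [[u ->]|[u [v [t [uv /andP[t0 t1] ->]]]]].
  by rewrite vdist_vertex => /Hv; exists u.
have nat01 (n : nat) (s : R) : 0 < s -> s < 1 -> n%:R + s = 1 -> False.
  by case: n => [|n]; [rewrite add0r | rewrite -natr1 => *; have := ler0n R n]; lra.
move: t0; rewrite le_eqVlt => /orP[/eqP<-|t0].
  by rewrite edge_point0 vdist_vertex => /Hv; exists u.
move: t1; rewrite le_eqVlt => /orP[/eqP->|t1].
  by rewrite edge_point1 vdist_vertex => /Hv; exists v.
rewrite vdist_edge //; try exact: ltW.
by case: leP => _ /nat01 []; lra.
Qed.

(** Once one vertex goes to a vertex, so do its neighbors in the ball, by [gdist1_vertex]. This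
    propagates from [v0] down to the center [x] and from there to the whole ball. *)
Lemma lisom_liso (X Y : graph) (m : nat) (x : X) (q : Y -> R) g v0 v1 :
  lisom m%:R (vertex_point R x) q g ->
  (dist x v0 <= m)%N -> g (vertex_point R v0) = vertex_point R v1 ->
  exists phi : X -> Y, liso m x phi /\
    forall u, (dist x u <= m)%N -> g (vertex_point R u) = vertex_point R (phi u).
Proof.
move=> [g1 g2 g3 g4 g5] Hv0 Ev0.
have inB u : (dist x u <= m)%N -> point_ball (vertex_point R x) m%:R (vertex_point R u).
  by move=> Hu; split; [apply: realization_vertex | rewrite gdist_vertices ler_nat].
pose isv u := exists w : Y, g (vertex_point R u) = vertex_point R w.
have step u v : adj u v -> (dist x u <= m)%N -> (dist x v <= m)%N -> isv u -> isv v.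
  move=> uv /inB Hu /inB Hv [w Ew].
  have := g3 _ _ Hu Hv; rewrite Ew gdist_vertices adj_dist //.
  move=> /gdist1_vertex; case; first by case: (g2 _ Hv).
  by move=> w' _ Ew'; exists w'.
have isx : isv x.
  have : isv v0 by exists v1.
  move E : (dist x v0) Hv0 => n; elim: n v0 E {Ev0} => [|n IH] v E Hn Hv.
    by rewrite (dist0_eq E).
  have [|z [vz Ez]] := @lower_neighbor _ x v; first by rewrite E.
  have Ezn : dist x z = n by lia.
  by apply: (IH z Ezn) => //; [lia | apply: (step v) => //; lia].
have allv u : (dist x u <= m)%N -> isv u.
  move E : (dist x u) => n; elim: n u E => [|n IH] u E Hn.
    by rewrite -(dist0_eq E).
  have [|z [uz Ez]] := @lower_neighbor _ x u; first by rewrite E.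
  have Ezn : dist x z = n by lia.
  by apply: (step z); rewrite 1?adj_symmetric //; [lia | lia | apply: IH => //; lia].
have /choice[phi Hphi] : forall u, exists w : Y,
    (dist x u <= m)%N -> g (vertex_point R u) = vertex_point R w.
  move=> u; case: (leqP (dist x u) m) => Hu; first by have [w Hw] := allv u Hu; exists w.
  by have [w] := graph_nonempty Y; exists w.
exists phi; split => //; split=> [u v Hu Hv E|u Hu w].
  apply: (@vertex_point_inj R); apply: g4; try exact: inB.
  by rewrite !Hphi // E.
split => [a|[v uv <-]]; last first.
  have Hv : (dist x v <= m)%N by have := dist_adj x uv; lia.
  have := g3 _ _ (inB _ (ltnW Hu)) (inB _ Hv).
  rewrite (Hphi _ (ltnW Hu)) (Hphi _ Hv) !gdist_vertices => /eqP.
  by rewrite eqr_nat (adj_dist uv) => /eqP/dist1_adj.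
have Rq : realization q by rewrite -g1; case: (g2 _ (inB x _)); rewrite ?distxx.
have Bu := inB _ (ltnW Hu).
have [|z Hz Ez] := g5 (vertex_point R w).
  split; first exact: realization_vertex.
  apply: le_trans (gdist_triangle Rq (realization_vertex R (phi u)) (realization_vertex R w)) _.
  rewrite gdist_vertices (adj_dist a) -g1 -(Hphi _ (ltnW Hu)) g3 ?gdist_vertices; last by [].
    by rewrite natr1 ler_nat.
  by apply: inB; rewrite distxx.
have := g3 _ _ Bu Hz; rewrite Ez (Hphi _ (ltnW Hu)) gdist_vertices (adj_dist a).
move=> /esym/gdist1_vertex[|v uv Ev]; first by case: Hz.
exists v => //; apply: (@vertex_point_inj R); rewrite -Ez Ev Hphi //.
by have := dist_adj x uv; lia.
Qed.

Lemma lisom_realization (X Y : graph) g p q (m : R) : realization p ->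
  is_isometry (@realization R X) (@realization R Y) g -> g p = q ->
  lisom m p q g.
Proof.
move=> Hp [[g1 g2 g3] g4] <-.
have E z z' : realization z -> realization z' -> gdist (g z) (g z') = gdist z z'.
  move=> Hz Hz'; apply: EFin_inj; rewrite -!geodesic_distE //; try exact: g1.
  exact: g4.
split => //.
- by move=> z [Hz Hm]; split; [apply: g1 | rewrite E].
- by move=> z z' [Hz _] [Hz' _]; apply: E.
- by move=> z z' [Hz _] [Hz' _]; apply: g2; rewrite inE.
move=> w [Hw Hm]; have [z Hz Ez] := g3 w Hw; exists z => //.
by split => //; move: Hm; rewrite -Ez E.
Qed.

(** An isometry realizing an orbit relation sends a vertex to a vertex, hence all vertices to
    vertices. The vertex maps found at the various radii agree because the isometry determines
    them. *)
Lemma cocompact_orbits (X : graph) : isometries_cocompact R X -> finitely_many_orbits X.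
Proof.
have Hid : is_isometry (@realization R X) (@realization R X) id.
  by split => //; split => // z Hz; exists z.
have Hx (x : X) : vertex_orbit R x x by exists id.
move=> /finite_seqP[s Hs].
have /choice[pick Hpick] : forall orb : set X, exists x,
    (exists y, vertex_orbit R y = orb) -> vertex_orbit R x = orb.
  move=> orb; have [[y Hy]|H] := pselect (exists y, vertex_orbit R y = orb).
    by exists y.
  by have [x] := graph_nonempty X; exists x.
exists [seq pick orb | orb <- s] => x.
have Ex : vertex_orbit R (pick (vertex_orbit R x)) = vertex_orbit R x.
  by apply: Hpick; exists x.
exists (pick (vertex_orbit R x)).
  apply/map_f; have : [set` s] (vertex_orbit R x) by rewrite -Hs; exists x.
  by [].
set x0 := pick _ in Ex *.
have [g Hg Eg] : vertex_orbit R x0 x by rewrite Ex.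
have Hphi n : exists phi : X -> X, liso n x0 phi /\
    forall u, (dist x0 u <= n)%N -> g (vertex_point R u) = vertex_point R (phi u).
  apply: (lisom_liso (v0 := x0) (v1 := x) _ _ Eg); last by rewrite distxx.
  by apply: (lisom_realization (p := vertex_point R x0)) => //; apply: realization_vertex.
have /choice[f Hf] : forall u, exists w, g (vertex_point R u) = vertex_point R w.
  by move=> u; have [phi [_ H]] := Hphi (dist x0 u); exists (phi u); apply: H.
exists f; split; first by apply: (@vertex_point_inj R); rewrite -Hf.
move=> n; have [phi [H1 H2]] := Hphi n; apply: (liso_ext H1) => u /H2.
by rewrite Hf => /vertex_point_inj.
Qed.

(** Points within [m] of [p] are within [c + m] of [x] and at most [2 * m] apart, so [c + 3 * m < r]
    makes their intrinsic distance ambient. Inverting [f] gives a map centered at the vertex [y]. *)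
Lemma isometry_ball_inverse (X Y : graph) (x : X) (y : Y) (r m c : R) f p :
  is_isometry (graph_ball x r) (graph_ball y r) f ->
  graph_ball x r p -> f p = vertex_point R y -> 0 <= m ->
  vdist x p <= c -> c + 3 * m < r ->
  exists g, lisom m (vertex_point R y) p g.
Proof.
move=> [[f1 f2 f3] f4] Bp Ep m0 Hc Hr.
have [Rp _] := (graph_ballE x r p).1 Bp.
have Ry := realization_vertex R y.
have c0 : 0 <= c by apply: le_trans Hc; rewrite -gdist_vertex // gdist_ge0 //; apply: realization_vertex.
have inj z z' : graph_ball x r z -> graph_ball x r z' -> f z = f z' -> z = z'.
  by move=> Hz Hz'; apply: f2; rewrite inE.
have /choice[g Hg] : forall q, exists z,
    graph_ball y r q -> graph_ball x r z /\ f z = q.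
  move=> q; have [H|H] := pselect (graph_ball y r q); last by exists p.
  by have [z Hz Ez] := f3 q H; exists z.
have inY q : point_ball (vertex_point R y) m q -> graph_ball y r q.
  move=> [Hq]; rewrite gdist_vertex // => Hm; apply/graph_ballE; split => //; lra.
(* Intrinsic distances from the center [y] are ambient, and ambient distances never exceed intrinsic
   ones, so preimages stay within [m] of [p]. *)
have key q : point_ball (vertex_point R y) m q -> point_ball p m (g q).
  move=> Hq; have Bq := inY _ Hq; have [Bz Ez] := Hg q Bq; case: Hq => Hq.
  rewrite gdist_vertex // => Hm; have [Rz _] := (graph_ballE x r (g q)).1 Bz.
  split => //; rewrite -lee_fin -geodesic_distE //.
  apply: le_trans (intrinsic_ge (A := graph_ball x r) _ _ _) _; first by move=> z [].
  by rewrite -f4 // Ez Ep intrinsic_center.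
have inX z : point_ball p m z -> vdist x z <= c + m.
  by move=> [Hz Hm]; have := vdist_lip x Rp Hz; lra.
have inX' z : point_ball p m z -> graph_ball x r z.
  by move=> Hz; have := inX z Hz; case: Hz => Hz _ H; apply/graph_ballE; split => //; lra.
have tri (Z : graph) (a b b' : Z -> R) : realization a ->
    point_ball a m b -> point_ball a m b' -> gdist b b' <= 2 * m.
  move=> Ha [Hb Hm] [Hb' Hm']; have := gdist_triangle Hb Ha Hb'.
  by rewrite (gdistC b a); lra.
exists g; split => //.
- have Hy : point_ball (vertex_point R y) m (vertex_point R y).
    by split => //; rewrite gdistxx.
  by have [Bz Ez] := Hg _ (inY _ Hy); apply: inj => //; rewrite Ez.
- move=> q q' Hq Hq'; apply: EFin_inj.
  have [[Rz Hz] [Rz' Hz']] := (key _ Hq, key _ Hq').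
  have [[Bz Ez] [Bz' Ez']] := (Hg _ (inY _ Hq), Hg _ (inY _ Hq')).
  have T1 := tri _ _ _ _ Ry Hq Hq'; have T2 := tri _ _ _ _ Rp (key _ Hq) (key _ Hq').
  have I := inX _ (key _ Hq).
  rewrite -(intrinsic_inner (x := x) (r := r)) //; last by lra.
  rewrite -f4 // Ez Ez' intrinsic_inner //; try by [case: Hq | case: Hq'].
  by case: (Hq) => Rq; rewrite gdist_vertex // => Hm; lra.
- move=> q q' Hq Hq' E.
  by have [[_ <-] [_ <-]] := (Hg _ (inY _ Hq), Hg _ (inY _ Hq')); rewrite E.
move=> z Hz; have Bz := inX' z Hz; have Bfz := f1 _ Bz.
have [Bg Eg] := Hg _ Bfz.
exists (f z); last exact: inj.
have [Rf _] := (graph_ballE y r _).1 Bfz.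
split => //; rewrite -lee_fin gdist_vertex // -(intrinsic_center Bfz) -Ep f4 //.
by case: Hz => Rz Hm; rewrite intrinsic_inner //; lra.
Qed.

End LocalIsometry.

(** * Quasi-isometries on vertices and the displacement of centers *)

Lemma quasi_isometry_vertices (R : realType) (X T : graph) :
  quasi_isometric R X T -> exists (F : X -> T) (L C : nat), forall x y,
    (dist (F x) (F y) <= L * dist x y + C)%N /\
    (dist x y <= L * dist (F x) (F y) + C)%N.
Proof.
move=> [f [L [C [L1 C0 fR fd _]]]].
have rv (Z : graph) := @realization_vertex R Z.
have /choice[F HF] : forall x : X, exists w : T, vdist w (f (vertex_point R x)) <= 1.
  by move=> x; apply: near_vertex; apply: fR; apply: rv.
(* [K] dominates both additive errors: [C + 2] in the upper bound, where each end is rounded to a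
   vertex, and [L * (2 + C)] after solving the lower bound for the distance in [X]. *)
pose K := (L + 1) * (C + 2).
have K0 : 0 <= K by rewrite /K; nra.
have [bL HL] : exists n : nat, L <= n%:R.
  by exists (Num.bound L); apply/ltW/archi_boundP; lra.
have [bK HK] : exists n : nat, K <= n%:R.
  by exists (Num.bound K); apply/ltW/archi_boundP.
exists F, bL, bK => x y.
set dx := dist x y; set dT := dist (F x) (F y).
have HfR z : realization (f (vertex_point R z)) by apply: fR; apply: rv.
have HF' z : gdist (vertex_point R (F z)) (f (vertex_point R z)) <= 1.
  by rewrite gdist_vertex.
set e := gdist (f (vertex_point R x)) (f (vertex_point R y)).
have e1 : dT%:R <= e + 2.
  rewrite -gdist_vertices.
  have := gdist_triangle (rv _ (F x)) (HfR x) (rv _ (F y)).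
  have := gdist_triangle (HfR x) (HfR y) (rv _ (F y)).
  by rewrite (gdistC (f (vertex_point R y)) (vertex_point R (F y))) -/e; have := HF' x; have := HF' y; lra.
have e2 : e <= dT%:R + 2.
  rewrite -gdist_vertices.
  have := gdist_triangle (HfR x) (rv _ (F x)) (HfR y).
  have := gdist_triangle (rv _ (F x)) (rv _ (F y)) (HfR y).
  by rewrite (gdistC (f (vertex_point R x)) (vertex_point R (F x))) -/e; have := HF' x; have := HF' y; lra.
have := fd _ _ (rv _ x) (rv _ y).
rewrite !geodesic_distE ?gdist_vertices // -/dx -/e -!EFinM -EFinB -EFinD !lee_fin.
move=> /andP[F1 F2].
have dx0 : (0 : R) <= dx%:R by rewrite ler0n.
have dT0 : (0 : R) <= dT%:R by rewrite ler0n.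
have LdK : L * dx%:R <= bL%:R * dx%:R by apply: ler_wpM2r.
have LdT : L * dT%:R <= bL%:R * dT%:R by apply: ler_wpM2r.
rewrite -!(ler_nat R) !natrD !natrM; split.
  have HC : C + 2 <= K by rewrite /K; nra.
  by lra.
have F3 : L^-1 * dx%:R <= dT%:R + 2 + C by lra.
have L0 : 0 < L by lra.
have F4 : dx%:R <= L * (dT%:R + 2 + C) by rewrite -ler_pdivrMl.
have HC : L * (2 + C) <= K by rewrite /K; nra.
by lra.
Qed.

(** The vertex [m] is moved to its orbit representative and then by an automorphism taking the
    representative of the orbit of [x] to [x]; [c] bounds the distances between representatives. *)
Lemma transport (X : graph) : finitely_many_orbits X -> exists c, forall (x m : X) n,
  exists f : X -> X, liso n m f /\ (dist x (f m) <= c)%N.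
Proof.
move=> [s Hs].
have [c Hc] : exists c, forall x0 m, x0 \in s -> (c <= m)%N ->
    forall x1, x1 \in s -> (dist x0 x1 <= m)%N.
  apply: uniform_bound => x0 _.
  have [c Hc] := @uniform_bound _ s (fun x1 m => (dist x0 x1 <= m)%N)
    (fun a _ => ex_intro _ (dist x0 a) (fun m H => H)).
  by exists c => m cm x1 x1s; apply: Hc.
exists c => x m n.
have [x0 x0s [a [Ea Ha]]] := Hs x; have [m0 m0s [b [Eb Hb]]] := Hs m.
have [b' [Hb' b'b _]] := liso_inverse (Hb n); rewrite Eb in Hb'.
have b'm : b' m = m0 by rewrite -Eb b'b // distxx.
exists (a \o b'); split.
  apply: liso_comp => //; rewrite b'm.
  exact: (liso_sub (Ha (dist x0 m0 + n)%N)).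
rewrite /= b'm -Ea (liso_dist_center (Ha (dist x0 m0))) //.
exact: Hc.
Qed.

Section Center.
Variables (R : realType) (X T : graph) (treeT : is_tree T) (F : X -> T) (L C : nat).
Hypothesis F_upper : forall x y, (dist (F x) (F y) <= L * dist x y + C)%N.
Hypothesis F_lower : forall x y, (dist x y <= L * dist (F x) (F y) + C)%N.
Hypothesis orbits : finitely_many_orbits X.

(* A point [p] within [r] of all of [graph_ball x r] is near [x]: move the middle
   of a long geodesic near [x] and compare [p] with its two ends. *)
Lemma center_bound : exists c, forall (r : nat) (x : X) (p : X -> R), (c <= r)%N ->
  realization p -> (forall u, (dist x u <= r)%N -> vdist u p <= r%:R) ->
  vdist x p <= c%:R.
Proof.
have near_center (x : X) (p : X -> R) w : realization p -> vdist w p <= 1 ->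
    vdist x p <= (dist x w).+1%:R :> R.
  move=> Hp Hw; apply: le_trans (vdist_lip x (realization_vertex R w) Hp) _.
  by rewrite vdist_vertex gdist_vertex // -natr1; lra.
(* In a bounded graph the bound on the diameter serves; otherwise there are geodesics of any
   length. *)
have [[M HM]|unb] := pselect (exists M, forall u v : X, (dist u v <= M)%N).
  exists M.+1 => r x p _ Hp _; have [w Hw] := near_vertex Hp.
  by apply: le_trans (near_center _ _ _ Hp Hw) _; rewrite ler_nat ltnS.
have [c Hc] := transport orbits.
(* The midpoint is within [c] of [x]; [almost_center] at radius [r.+1], with [r - N = c], gives
   [2 * (c + 1)] plus six tripod constants; replacing [p] by the vertex [w] costs one more. *)
exists (3 * c + 6 * tripod_const L C + 3)%N => r x p cr Hp Hr.
have [w Hw] := near_vertex Hp.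
apply: le_trans (near_center _ _ _ Hp Hw) _; rewrite ler_nat.
(* Points at distance [N] from a vertex within [c] of [x] stay in the ball of radius [r]. *)
pose N := (r - c)%N.
have [u0 [v0 Huv]] : exists u v : X, (2 * N < dist u v)%N.
  apply: contrapT => H; apply: unb; exists (2 * N)%N => u v.
  by rewrite leqNgt; apply/negP => H'; apply: H; exists u, v.
have [v [Ev1 Ev2]] := geodesic_point (ltnW Huv).
have [m [Em1 Em2]] := @geodesic_point _ u0 v N ltac:(lia).
(* The radius is [N] to reach the end [u0] plus [2 * N] to measure from there to [v]. *)
have [f [Hf Hd]] := Hc x m (N + 2 * N)%N.
have Hum : dist (f u0) (f m) = N.
  by rewrite distC (liso_dist_center Hf) distC; lia.
have Hmv : dist (f m) (f v) = N by rewrite (liso_dist_center Hf); lia.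
have Huv' : dist (f u0) (f v) = (2 * N)%N.
  by rewrite (liso_dist Hf) // distC; lia.
have far z : dist (f m) z = N -> (dist z w <= r.+1)%N.
  move=> Hz; have Hxz : (dist x z <= r)%N by have := dist_triangle (f m) x z; lia.
  have := gdist_triangle (realization_vertex R z) Hp (realization_vertex R w).
  rewrite (gdistC p) !gdist_vertices !gdist_vertex // => H.
  by rewrite -(ler_nat R) -natr1; have := Hr z Hxz; lra.
have Hmu : dist (f m) (f u0) = N by rewrite distC.
have := almost_center treeT F_upper F_lower Hum Hmv Huv' (far _ Hmu) (far _ Hmv).
by have := dist_triangle (f m) x w; lia.
Qed.

(* The isometry of balls need not map center to center, hence [p]. *)
Lemma locally_lisom : exists c : nat, forall (m : nat) (Y : graph),
  is_locally ((c + 3 * m).+1%:R : R) X Y ->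
  forall y : Y, exists (p : X -> R) g, [/\ realization p,
    lisom m%:R (vertex_point R y) p g & exists x : X, vdist x p <= c%:R].
Proof.
have [c Hc] := center_bound; exists c => m Y loc y.
set r := (c + 3 * m).+1 in loc.
have [x [f Hf]] := loc y; have [[f1 f2 f3] f4] := Hf.
have r0 : 0 <= r%:R :> R by rewrite ler0n.
have [p Bp Ep] : exists2 p, graph_ball x r%:R p & f p = vertex_point R y.
  apply: f3; apply/graph_ballE; split; first exact: realization_vertex.
  by rewrite vdist_vertex distxx.
have [Rp _] := (graph_ballE x _ p).1 Bp.
(* Every point of the ball about [y] is within [r] of [y], so every vertex of the ball about [x] is
   within [r] of [p], as [center_bound] demands. *)
have cp : vdist x p <= c%:R.
  apply: (Hc r) => //; first by rewrite /r; lia.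
  move=> u Hu.
  have Bu : graph_ball x r%:R (vertex_point R u).
    by apply/graph_ballE; split; [apply: realization_vertex | rewrite vdist_vertex ler_nat].
  have [_ Hfu] := (graph_ballE _ _ _).1 (f1 _ Bu).
  rewrite -gdist_vertex // gdistC -lee_fin -geodesic_distE //; last exact: realization_vertex.
  apply: le_trans (intrinsic_ge (A := graph_ball x r%:R) _ _ _) _; first by move=> z [].
  by rewrite -f4 // Ep intrinsic_center ?lee_fin //; apply: f1.
have [||g Hg] := isometry_ball_inverse (m := m%:R) Hf Bp Ep _ cp.
- by rewrite ler0n.
- have -> : r%:R = c%:R + 3 * m%:R + 1 :> R by rewrite /r -[LHS]natr1 natrD natrM.
  by lra.
by exists p, g; split => //; exists x.
Qed.

End Center.

(** * Small spheres *)

Section Germs.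
Variable R : realType.

Definition two_neighbors (X : graph) (w : X) : Prop :=
  exists a b, a <> b /\ forall z, adj w z <-> z = a \/ z = b.

(** A metric invariant: all small spheres have exactly two points. Interior points of edges have it,
    and a vertex has it exactly when its degree is 2. *)
Definition two_germ (X : graph) (q : X -> R) : Prop :=
  exists2 e0 : R, 0 < e0 & forall e, 0 < e -> e < e0 ->
  exists z1 z2, z1 <> z2 /\
    forall z, realization z /\ gdist q z = e <-> z = z1 \/ z = z2.

Lemma edge_point_inj (X : graph) (w u v : X) (e : R) : adj w u -> adj w v ->
  0 < e -> edge_point w u e = edge_point w v e -> u = v.
Proof.
move=> wu wv e0 /(congr1 (fun f => f u)); rewrite edge_pointr // => E.
apply: contrapT => H; move: E; rewrite edge_point_out //; first by lra.
by move=> E; move: wu; rewrite E adj_irreflexive.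
Qed.

Lemma natr_lt1 (n : nat) (e : R) : n%:R + e < 1 -> 0 <= e -> n = 0%N.
Proof.
case: n => // n; rewrite -natr1 => H e0; exfalso.
by have := ler0n R n; lra.
Qed.

Lemma small_sphere (X : graph) (w : X) (e : R) z : 0 < e -> e < 1 ->
  realization z /\ gdist (vertex_point R w) z = e <->
  exists2 u, adj w u & z = edge_point w u e.
Proof.
move=> e0 e1; split; last first.
  move=> [u wu ->]; have Hr : realization (edge_point w u e).
    by apply: realization_edge => //; lra.
  by split => //; rewrite gdist_vertex // vdist_edge ?distxx ?(adj_dist wu) //; case: leP => ?; lra.
move=> [Hz]; rewrite gdist_vertex //; move: Hz.
move=> [[u ->]|[u [v [t [uv /andP[t0 t1] ->]]]]].
  rewrite vdist_vertex => E; have := @natr_lt1 (dist w u) 0.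
  rewrite addr0 E => /(_ e1 (lexx _)) D; move: E; rewrite D; lra.
rewrite vdist_edge //; case: leP => _ E.
  have /dist0_eq Eu : dist w u = 0%N by apply: (@natr_lt1 _ t) => //; lra.
  by subst u; exists v => //; move: E; rewrite distxx add0r => ->.
have /dist0_eq Ev : dist w v = 0%N by apply: (@natr_lt1 _ (1 - t)) => //; lra.
subst v; exists u; first by rewrite adj_symmetric.
by move: E; rewrite distxx add0r => <-; rewrite -edge_pointC.
Qed.

Lemma germ_vertex (X : graph) (w : X) : two_germ (vertex_point R w) <-> two_neighbors w.
Proof.
split.
  move=> [e0 e00 H]; pose e := Num.min e0 1 / 2.
  have [ep [ee0 e1]] : 0 < e /\ e < e0 /\ e < 1 by rewrite /e; case: (leP e0 1) => ?; lra.
  have [z1 [z2 [z12 Hz]]] := H e ep ee0.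
  have sph := small_sphere w _ ep e1.
  have [a wa Ea] := (sph z1).1 ((Hz z1).2 (or_introl erefl)).
  have [b wb Eb] := (sph z2).1 ((Hz z2).2 (or_intror erefl)).
  exists a, b; split => [ab|z]; first by apply: z12; rewrite Ea Eb ab.
  split=> [wz|[->|->]] //.
  have [E|E] := (Hz _).1 ((sph _).2 (ex_intro2 _ _ z wz erefl)).
    by left; apply: (edge_point_inj wz wa ep); rewrite E.
  by right; apply: (edge_point_inj wz wb ep); rewrite E.
move=> [a [b [ab H]]]; exists 1 => // e e0 e1.
have wa : adj w a by apply/H; left.
have wb : adj w b by apply/H; right.
exists (edge_point w a e), (edge_point w b e); split.
  by move=> /(edge_point_inj wa wb e0).
move=> z; rewrite (small_sphere w z e0 e1); split=> [[u /H[->|->] ->]|[->|->]].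
- by left.
- by right.
- by exists a.
- by exists b.
Qed.

Lemma germ_nonvertex (X : graph) (q : X -> R) : realization q ->
  (forall u, q <> vertex_point R u) -> two_germ q.
Proof.
move=> [[u ->] /(_ u)//|[a [b [t [ab /andP[t0 t1] ->]]]]] nv.
have {}t0 : 0 < t.
  by rewrite lt_neqAle t0 andbT; apply/eqP => E; apply: (nv a); rewrite -E edge_point0.
have {}t1 : t < 1.
  by rewrite lt_neqAle t1 andbT; apply/eqP => E; apply: (nv b); rewrite E edge_point1.
exists (Num.min t (1 - t)); first by rewrite lt_min; lra.
move=> e e0; rewrite lt_min => /andP[et et'].
have Rs (s : R) : 0 <= s -> s <= 1 -> realization (edge_point a b s).
  by move=> *; apply: realization_edge.
have Rq : realization (edge_point a b t) by apply: Rs; lra.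
have da (s : R) : 0 <= s -> s <= 1 -> vdist a (edge_point a b s) = s.
  by move=> s0 s1; rewrite vdist_edge // distxx (adj_dist ab); case: leP => ?; lra.
have db (s : R) : 0 <= s -> s <= 1 -> vdist b (edge_point a b s) = 1 - s.
  move=> s0 s1; rewrite vdist_edge // distxx adj_dist; last by rewrite adj_symmetric.
  by case: leP => ?; lra.
have on_edge (s : R) : 0 <= s -> s <= 1 -> gdist (edge_point a b t) (edge_point a b s) = `|t - s|.
  move=> s0 s1; apply/eqP; rewrite eq_le; apply/andP; split.
    by apply: gdist_edge => //; lra.
  have := vdist_lip a Rq (Rs s s0 s1); have := vdist_lip a (Rs s s0 s1) Rq.
  by rewrite (gdistC (edge_point a b s)) !da; try lra; rewrite ler_norml; lra.
exists (edge_point a b (t - e)), (edge_point a b (t + e)); split.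
  by move=> /(congr1 (fun f => f b)); rewrite !edge_pointr //; lra.
move=> z; split; last first.
  case=> ->; split; try by apply: Rs; lra.
    rewrite on_edge; try lra.
    by rewrite ger0_norm; lra.
  rewrite on_edge; try lra.
  by rewrite ler0_norm; lra.
move=> [Rz Ez].
(* As [e] is less than [t] and [1 - t], the point [z] is at distance less than 1 from both [a] and
   [b], which forces it onto their edge. *)
suff [s [Es s0 s1]] : exists s, [/\ z = edge_point a b s, 0 <= s & s <= 1].
  move: Ez; rewrite Es on_edge //; case: (leP 0 (t - s)) => H.
    by rewrite ger0_norm // => ?; left; congr edge_point; lra.
  by rewrite ltr0_norm // => ?; right; congr edge_point; lra.
have Ha : vdist a z < 1 by have := vdist_lip a Rq Rz; rewrite da; lra.
have Hb : vdist b z < 1 by have := vdist_lip b Rq Rz; rewrite db; lra.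
have nvz u : z <> vertex_point R u.
  move=> E; move: Ha Hb; rewrite E !vdist_vertex => Ha Hb.
  have /dist0_eq Ea : dist a u = 0%N by apply: (@natr_lt1 _ 0); rewrite ?addr0.
  have /dist0_eq Eb : dist b u = 0%N by apply: (@natr_lt1 _ 0); rewrite ?addr0.
  by move: ab; rewrite Ea Eb adj_irreflexive.
case: Rz => [[u /nvz//]|[u [v [s [uv /andP[s0 s1] Es]]]]].
have end_of w : vdist w z < 1 -> w = u \/ w = v.
  rewrite Es vdist_edge // gt_min => /orP[H|H].
    by left; apply: dist0_eq; apply: natr_lt1 H _.
  by right; apply: dist0_eq; apply: natr_lt1 H _; lra.
have [Eu|Ev] := end_of a Ha; have [Eu'|Ev'] := end_of b Hb.
- by move: ab; rewrite Eu Eu' adj_irreflexive.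
- by exists s; rewrite Eu Ev'.
- by exists (1 - s); rewrite Ev Eu' -edge_pointC; split => //; lra.
- by move: ab; rewrite Ev Ev' adj_irreflexive.
Qed.

Lemma lisom_sub (X Y : graph) (m m' : R) (p z : X -> R) (q : Y -> R) g :
  realization p -> lisom m p q g -> realization z -> 0 <= m' ->
  gdist p z + m' <= m -> lisom m' z (g z) g.
Proof.
move=> Rp [g1 g2 g3 g4 g5] Rz m0 H.
have sub a : point_ball z m' a -> point_ball p m a.
  by move=> [Ra Ha]; split => //; have := gdist_triangle Rp Rz Ra; lra.
have Bz : point_ball p m z by split => //; lra.
have Bp : point_ball p m p by split => //; rewrite gdistxx //; have := gdist_ge0 Rp Rz; lra.
have [Rgz Hgz] := g2 _ Bz.
have Rq : realization q by rewrite -g1; case: (g2 _ Bp).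
split => //.
- move=> a Ha; have [Rga _] := g2 _ (sub _ Ha); split => //.
  by rewrite g3 //; [case: Ha | apply: sub].
- by move=> a b Ha Hb; apply: g3; apply: sub.
- by move=> a b Ha Hb; apply: g4; apply: sub.
move=> w [Rw Hw].
have [|a Ha Ea] := g5 w.
  split => //; have := gdist_triangle Rq Rgz Rw.
  by rewrite -{2}g1 g3 //; lra.
exists a => //; case: (Ha) => Ra _; split => //.
by rewrite -(g3 _ _ Bz Ha) Ea.
Qed.

Lemma germ_lisom (X Y : graph) (m : R) (p : X -> R) (q : Y -> R) g :
  realization p -> 0 < m -> lisom m p q g -> two_germ p <-> two_germ q.
Proof.
move=> Rp m0 [g1 g2 g3 g4 g5].
have Bp : point_ball p m p by split => //; rewrite gdistxx //; lra.
have qE a : point_ball p m a -> gdist q (g a) = gdist p a.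
  by move=> Ha; rewrite -{1}g1 g3.
split=> -[e0 e00 H]; exists (Num.min e0 m); rewrite ?lt_min ?e00 // => e ep;
  rewrite lt_min => /andP[ee0 em]; have [z1 [z2 [z12 Hz]]] := H e ep ee0.
  have B a : realization a /\ gdist p a = e -> point_ball p m a.
    by move=> [Ra Ha]; split => //; lra.
  have S1 := (Hz z1).2 (or_introl erefl); have S2 := (Hz z2).2 (or_intror erefl).
  have [B1 B2] := (B _ S1, B _ S2).
  exists (g z1), (g z2); split; first by move=> /(g4 _ _ B1 B2).
  move=> z; split => [[Rz Ez]|[->|->]].
  - have [|a Ba Ea] := g5 z; first by split => //; lra.
    have [E|E] : a = z1 \/ a = z2 by apply/Hz; split; [case: Ba | rewrite -qE // Ea].
      by left; rewrite -Ea E.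
    by right; rewrite -Ea E.
  - by split; [case: (g2 _ B1) | rewrite qE //; case: S1].
  - by split; [case: (g2 _ B2) | rewrite qE //; case: S2].
have S1 := (Hz z1).2 (or_introl erefl); have S2 := (Hz z2).2 (or_intror erefl).
have [|a1 B1 E1] := g5 z1; first by case: S1 => ? ?; split => //; lra.
have [|a2 B2 E2] := g5 z2; first by case: S2 => ? ?; split => //; lra.
exists a1, a2; split; first by move=> E; apply: z12; rewrite -E1 -E2 E.
move=> z; split => [[Rz Ez]|[->|->]].
- have Bz : point_ball p m z by split => //; lra.
  have [] : g z = z1 \/ g z = z2 by apply/Hz; split; [case: (g2 _ Bz) | rewrite qE].
    by rewrite -E1 => /(g4 _ _ Bz B1); left.
  by rewrite -E2 => /(g4 _ _ Bz B2); right.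
- by split; [case: B1 | rewrite -qE // E1; case: S1].
- by split; [case: B2 | rewrite -qE // E2; case: S2].
Qed.

(** The preimage of [v] cannot be interior to an edge, for then [v] would have a two-point germ. The
    extra unit of radius leaves a ball around the preimage on which to compare germs. *)
Lemma lisom_vertex (X Y : graph) (m : nat) (x : X) (q : Y -> R) g (v : Y) :
  lisom m.+1%:R (vertex_point R x) q g -> realization q ->
  gdist q (vertex_point R v) <= m%:R -> ~ two_neighbors v ->
  exists2 u, (dist x u <= m)%N & g (vertex_point R u) = vertex_point R v.
Proof.
move=> Hg Rq Hv nv; have [g1 g2 g3 g4 g5] := Hg.
have mS : m%:R <= m.+1%:R :> R by rewrite ler_nat.
have Rx := realization_vertex R x.
have Bx : point_ball (vertex_point R x) m.+1%:R (vertex_point R x).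
  by split => //; rewrite gdistxx.
have [|z Bz Ez] := g5 (vertex_point R v).
  by split; [apply: realization_vertex | lra].
have Dz : gdist (vertex_point R x) z <= m%:R by rewrite -g3 // g1 Ez.
have [u Eu] : exists u, z = vertex_point R u.
  apply: contrapT => H; apply: nv; apply/germ_vertex.
  case: (Bz) => Rz _.
  have Hz : lisom 1 z (g z) g by apply: (lisom_sub Rx Hg) => //; rewrite -natr1; lra.
  rewrite -Ez; apply/(germ_lisom Rz _ Hz) => //.
  by apply: germ_nonvertex => // u Eu; apply: H; exists u.
by exists u; rewrite -?Eu //; move: Dz; rewrite Eu gdist_vertices ler_nat.
Qed.

Lemma lisom_two_neighbors (X Y : graph) (x : X) (q : Y -> R) g :
  lisom 1 (vertex_point R x) q g -> realization q ->
  (forall v : Y, two_neighbors v) -> two_neighbors x.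
Proof.
move=> Hg Rq H; apply/germ_vertex/(germ_lisom _ _ Hg) => //.
  exact: realization_vertex.
have [[u ->]|Hu] := pselect (exists u, q = vertex_point R u); first exact/germ_vertex.
by apply: germ_nonvertex => // u E; apply: Hu; exists u.
Qed.

End Germs.

(** * Two-regular graphs *)

Section Biwalk.
Variable X : graph.

(** A walk without backtracking, infinite in both directions: it parametrizes a line, or winds
    around a cycle. *)
Definition biwalk (z : int -> X) : Prop := forall i, z (i - 1) <> z (i + 1) /\
  forall w, adj (z i) w <-> w = z (i - 1) \/ w = z (i + 1).

Lemma biwalk_exists : (forall x : X, two_neighbors x) -> exists z, biwalk z.
Proof.
move=> H.
(* [oth (a, b)] is the neighbor of [b] other than [a]; iterating it continues a walk without
   backtracking. *)
have /choice[oth Hoth] : forall ab : X * X, exists c, adj ab.2 ab.1 ->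
    ab.1 <> c /\ forall w, adj ab.2 w <-> w = ab.1 \/ w = c.
  move=> [a b] /=; have [u [v [uv Huv]]] := H b.
  case: (boolP (adj b a)) => [/Huv[->|->]|_]; last by exists a.
    by exists v.
  exists u => _; split => [E|w]; first by apply: uv.
  by rewrite Huv; tauto.
pose st (ab : X * X) := (ab.2, oth ab).
pose h ab n := (iter n st ab).1.
have hS ab n : iter n st ab = (h ab n, h ab n.+1) by rewrite /h /=; case: (iter n st ab).
have hadj ab n : adj ab.1 ab.2 -> adj (h ab n) (h ab n.+1).
  move=> a; elim: n => [|n IH]; first by rewrite /h /=.
  have E : h ab n.+2 = oth (h ab n, h ab n.+1) by rewrite -hS.
  rewrite E; have [|_ /(_ (oth (h ab n, h ab n.+1)))] := Hoth (h ab n, h ab n.+1) => /=.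
    by rewrite adj_symmetric.
  by move=> ->; right.
have hnext ab n : adj ab.1 ab.2 -> h ab n <> h ab n.+2 /\
    forall w, adj (h ab n.+1) w <-> w = h ab n \/ w = h ab n.+2.
  move=> a.
  have E : h ab n.+2 = oth (h ab n, h ab n.+1) by rewrite -hS.
  by rewrite E; apply: (Hoth (h ab n, h ab n.+1)); rewrite /= adj_symmetric hadj.
have [a] := graph_nonempty X; have [b [c [bc Hbc]]] := H a.
have ab : adj a b by apply/Hbc; left.
have ac : adj a c by apply/Hbc; right.
(* Both rays start at [a]. Since [Negz n] is [-(n + 1)], the second is shifted by one so that [a]
   occurs only at index 0. *)
pose z (i : int) := match i with Posz n => h (a, b) n | Negz n => h (a, c) n.+1 end.
exists z => -[[|n]|n].
- have -> : 0%N%:Z - 1 = Negz 0 by [].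
  have -> : 0%N%:Z + 1 = 1%N by [].
  rewrite /z /h /=; split => [E|w]; first by apply: bc.
  by rewrite Hbc; tauto.
- have -> : n.+1%:Z - 1 = n by lia.
  have -> : n.+1%:Z + 1 = n.+2 by lia.
  exact: hnext.
- have -> : Negz n - 1 = Negz n.+1 by lia.
  have [E1 E2] := hnext (a, c) n ac.
  have -> : z (Negz n + 1) = h (a, c) n.
    by case: n {E1 E2} => [|n] //; have -> : Negz n.+1 + 1 = Negz n by lia.
  by split => [E|w]; [apply: E1 | rewrite E2 /=; tauto].
Qed.

Variables (z : int -> X) (zP : biwalk z).

Lemma biwalk_adj i : adj (z i) (z (i + 1)).
Proof. by apply/(zP i).2; right. Qed.

Lemma biwalk_surj x : exists i, x = z i.
Proof.
have [p] := graph_connected (z 0) x; move: (0 : int).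
elim: p => [|b p IH] i /=; first by move=> _ ->; exists i.
by move=> /andP[/(zP i).2[->|->]]; apply: IH.
Qed.

Lemma biwalk_dist i (n : nat) : (dist (z i) (z (i + n%:Z)) <= n)%N.
Proof.
elim: n => [|n IH]; first by rewrite addr0 distxx.
have -> : i + n.+1%:Z = i + n%:Z + 1 by lia.
by have := dist_adj (z i) (biwalk_adj (i + n%:Z)); lia.
Qed.

Lemma biwalk_forward i j : z i = z j -> z (i + 1) = z (j + 1) ->
  z (i + 1 + 1) = z (j + 1 + 1).
Proof.
move=> E E1.
have [N /(_ (z (i + 1 + 1))) A] := zP (i + 1).
have [_ /(_ (z (i + 1 + 1))) B] := zP (j + 1).
have : adj (z (j + 1)) (z (i + 1 + 1)) by rewrite -E1; apply: biwalk_adj.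
move=> /B[] // E2; case: N; rewrite E2; have -> : i + 1 - 1 = i by lia.
by have -> : j + 1 - 1 = j by lia.
Qed.

Lemma biwalk_backward i j : z i = z j -> z (i + 1) = z (j + 1) ->
  z (i - 1) = z (j - 1).
Proof.
move=> E E1; have [N _] := zP i; have [_ /(_ (z (i - 1))) B] := zP j.
have : adj (z j) (z (i - 1)) by rewrite -E; apply/(zP i).2; left.
by move=> /B[] // E2; case: N; rewrite E2.
Qed.

Lemma biwalk_shift i j : z i = z j -> z (i + 1) = z (j + 1) ->
  forall k, z (i + k) = z (j + k).
Proof.
move=> E E1.
have fwd (n : nat) : z (i + n%:Z) = z (j + n%:Z) /\ z (i + n%:Z + 1) = z (j + n%:Z + 1).
  elim: n => [|n [IH1 IH2]]; first by rewrite !addr0.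
  have -> : i + n.+1%:Z = i + n%:Z + 1 by lia.
  have -> : j + n.+1%:Z = j + n%:Z + 1 by lia.
  by split => //; apply: biwalk_forward.
have bwd (n : nat) : z (i - n%:Z) = z (j - n%:Z) /\ z (i - n%:Z + 1) = z (j - n%:Z + 1).
  elim: n => [|n [IH1 IH2]]; first by rewrite !subr0.
  have -> : i - n.+1%:Z = i - n%:Z - 1 by lia.
  have -> : j - n.+1%:Z = j - n%:Z - 1 by lia.
  by rewrite !subrK; split => //; apply: biwalk_backward.
case=> n; first by case: (fwd n).
by rewrite NegzE; case: (bwd n.+1).
Qed.

(** If the walk came back reversed, both ends could be moved inward by one step repeatedly, down to
    a backtracking ([n = 0]) or a loop ([n = 1]). *)
Lemma biwalk_no_reflection (n : nat) i : z i = z (i + n%:Z) ->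
  z (i + 1) = z (i + n%:Z - 1) -> False.
Proof.
elim/ltn_ind: n i => -[|[|n]] IH i E E1.
- by have [[]] := zP i; rewrite E1 addr0.
- exact: (adj_neq (biwalk_adj i)).
apply: (IH n _ (i + 1)) => //.
  by rewrite E1; congr z; lia.
have -> : i + 1 + n%:Z = i + n.+2%:Z - 1 by lia.
have [N _] := zP (i + 1); have [_ /(_ (z (i + 1 + 1))) B] := zP (i + n.+2%:Z - 1).
have : adj (z (i + n.+2%:Z - 1)) (z (i + 1 + 1)) by rewrite -E1; apply: biwalk_adj.
move=> /B[] // E2; case: N; rewrite E2 subrK -E; congr z; lia.
Qed.

Definition period (P : nat) := (0 < P)%N /\ forall i, z (i + P%:Z) = z i.

(** After a collision the walk continues either in reverse, which is excluded, or in the same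
    direction, and then two consecutive values determine it. *)
Lemma collision_period i (n : nat) : (0 < n)%N -> z i = z (i + n%:Z) -> period n.
Proof.
move=> n0 E.
have : adj (z (i + n%:Z)) (z (i + 1)) by rewrite -E; apply: biwalk_adj.
move=> /(zP _).2[E1|E1]; first by case: (biwalk_no_reflection E E1).
split=> // k; have := biwalk_shift E E1 (k - i).
have -> : i + (k - i) = k by lia.
by have -> : i + n%:Z + (k - i) = k + n%:Z by lia.
Qed.

Lemma period_mul P i (k : int) : period P -> z (i + P%:Z * k) = z i.
Proof.
move=> [_ HP].
have fwd i' (n : nat) : z (i' + P%:Z * n%:Z) = z i'.
  elim: n => [|n IH]; first by rewrite mulr0 addr0.
  have -> : i' + P%:Z * n.+1%:Z = i' + P%:Z * n%:Z + P%:Z by lia.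
  by rewrite HP.
case: k => n; first exact: fwd.
rewrite -(fwd (i + P%:Z * Negz n) n.+1); congr z; rewrite NegzE; lia.
Qed.

Lemma period_mod P i : period P -> exists k (m : int),
  (k < P)%N /\ i = k%:Z + P%:Z * m.
Proof.
move=> [P0 _]; exists `|(i %% P%:Z)%Z|%N, (i %/ P%:Z)%Z.
have Pnz : P%:Z != 0 by lia.
have H0 := modz_ge0 i Pnz; have H1 := ltz_mod i Pnz; have H2 := divz_eq i P%:Z.
by split; lia.
Qed.

Definition minimal_period P := period P /\
  forall i j : nat, (i < P)%N -> (j < P)%N -> z i%:Z = z j%:Z -> i = j.

Lemma injective_or_period : injective z \/ exists P, minimal_period P.
Proof.
have [H|H] := pselect (exists P, period P); last first.
  left=> i j E; apply: contrapT => ij; apply: H.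
  case: (ltP i j) => Hij.
    by exists `|j - i|%N; apply: (@collision_period i); [lia | rewrite E; congr z; lia].
  by exists `|i - j|%N; apply: (@collision_period j); [lia | rewrite -E; congr z; lia].
right; have ex : exists P, `[< period P >] by case: H => P ?; exists P; apply/asboolP.
case: (ex_minnP ex) => P /asboolP HP Pmin; exists P; split => //.
have key (i j : nat) : (i < j)%N -> (j < P)%N -> z i%:Z <> z j%:Z.
  move=> ij jP E; have : period (j - i)%N.
    by apply: (@collision_period i); [lia | rewrite E; congr z; lia].
  by move=> /asboolP/Pmin; lia.
move=> i j iP jP E; case: (ltngtP i j) => // H'; first by case: (key i j).
by case: (key j i).
Qed.

(** The [P] half-open edges cover the whole graph. *)
Lemma period_slot (R : realType) P (q : X -> R) : period P -> realization q ->
  exists2 k : 'I_P, True & exists t : R,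
    [/\ 0 <= t, t < 1 & q = edge_point (z k%:Z) (z (k%:Z + 1)) t].
Proof.
move=> HP Hq.
have red i t : 0 <= t -> t < 1 -> q = edge_point (z i) (z (i + 1)) t ->
    exists2 k : 'I_P, True & exists t : R,
    [/\ 0 <= t, t < 1 & q = edge_point (z k%:Z) (z (k%:Z + 1)) t].
  move=> t0 t1 ->; have [k [m [kP ->]]] := period_mod i HP.
  exists (Ordinal kP) => //; exists t; split => //=.
  by rewrite addrAC !period_mul.
have vert u : q = vertex_point R u -> exists2 k : 'I_P, True & exists t : R,
    [/\ 0 <= t, t < 1 & q = edge_point (z k%:Z) (z (k%:Z + 1)) t].
  have [i ->] := biwalk_surj u => E; apply: (red i 0) => //.
  by rewrite edge_point0.
case: Hq => [[u /vert//]|[u [v [t [uv /andP[t0 t1] E]]]]].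
move: t0; rewrite le_eqVlt => /orP[/eqP t0|t0].
  by apply: (vert u); rewrite E -t0 edge_point0.
move: t1; rewrite le_eqVlt => /orP[/eqP t1|t1].
  by apply: (vert v); rewrite E t1 edge_point1.
have [i Ei] := biwalk_surj u; subst u.
move: uv => /(zP i).2[Ev|Ev]; subst v; last by apply: (red i t) => //; lra.
apply: (red (i - 1) (1 - t)); [lra | lra | ].
by rewrite subrK -edge_pointC.
Qed.

(** Pigeonhole: two of [P + 1] points share a half-open edge and are at distance less than 1. This
    compares lengths of cycles even when vertices are not sent to vertices. *)
Lemma separated_points (R : realType) P (q : nat -> X -> R) : period P ->
  (forall i, (i <= P)%N -> realization (q i)) ->
  ~ (forall i j, (i < j)%N -> (j <= P)%N -> 1 <= gdist (q i) (q j)).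
Proof.
move=> HP Rq H.
have /choice[s Hs] : forall i : 'I_P.+1, exists k : 'I_P, exists t : R,
    [/\ 0 <= t, t < 1 & q i = edge_point (z k%:Z) (z (k%:Z + 1)) t].
  move=> i; have [|k _ Hk] := @period_slot R P (q i) HP; last by exists k.
  by apply: Rq; rewrite -ltnS.
have key (i j : 'I_P.+1) : (i < j)%N -> s i <> s j.
  move=> ij E; have [t [t0 t1 Et]] := Hs i; have [t' [t0' t1' Et']] := Hs j.
  have := H i j ij; rewrite -ltnS ltn_ord => /(_ isT).
  rewrite Et Et' E => D.
  have D' := @gdist_edge R X _ _ t t' (biwalk_adj (s j)%:Z) ltac:(lra) ltac:(lra).
  have : `|t - t'| < 1 by rewrite ltr_norml; lra.
  by lra.
have inj : injective s.
  move=> i j E; apply/val_inj => /=; case: (ltngtP i j) => // ij.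
    by case: (key i j).
  by case: (key j i).
by have := leq_card s inj; rewrite !card_ord ltnn.
Qed.

End Biwalk.

Lemma covering_of_biwalks (X Y : graph) (z : int -> X) (y : int -> Y) :
  biwalk z -> biwalk y -> (forall i j, z i = z j -> y i = y j) ->
  Defs.covered_by Y X.
Proof.
move=> Hz Hy W.
have /choice[f Hf] : forall x, exists v, exists i, x = z i /\ v = y i.
  by move=> x; have [i ->] := biwalk_surj Hz x; exists (y i), i.
have fz i : f (z i) = y i by have [j [E ->]] := Hf (z i); apply/esym/W.
exists f; apply: covering_of_liso1 => x; have [i ->] := biwalk_surj Hz x.
have [N1 A1] := Hz i; have [N2 A2] := Hy i.
have ball u : (dist (z i) u <= 1)%N -> [\/ u = z i, u = z (i - 1) | u = z (i + 1)].
  rewrite leq_eqVlt ltnS leqn0 => /orP[/eqP/dist1_adj/A1[]|/eqP/dist0_eq] ->.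
  - by constructor 2.
  - by constructor 3.
  - by constructor 1.
have Np : y i <> y (i + 1) by apply: adj_neq; apply/A2; right.
have Nm : y i <> y (i - 1) by apply: adj_neq; apply/A2; left.
split=> [u v /ball Hu /ball Hv|u].
  by case: Hu => ->; case: Hv => -> //; rewrite !fz;
     [move=> /Nm | move=> /Np | move=> /esym/Nm | move=> /N2 | move=> /esym/Np
     | move=> /esym/N2].
rewrite ltnS leqn0 => /eqP/dist0_eq <- w; rewrite fz A2; split.
  case=> ->; first by exists (z (i - 1)); [apply/A1; left | rewrite fz].
  by exists (z (i + 1)); [apply/A1; right | rewrite fz].
by move=> [v /A1[->|->] <-]; rewrite fz; [left | right].
Qed.

Lemma liso_two_neighbors (X Y : graph) (v : X) (f : X -> Y) :
  liso 1 v f -> two_neighbors (f v) -> two_neighbors v.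
Proof.
move=> [inj nbr] [a [b [ab H]]].
have nbrv := nbr v; rewrite distxx in nbrv; have {nbrv}nbrv := nbrv isT.
have [a' va' Ea] := (nbrv a).1 ((H a).2 (or_introl erefl)).
have [b' vb' Eb] := (nbrv b).1 ((H b).2 (or_intror erefl)).
have I u w : adj v u -> adj v w -> f u = f w -> u = w.
  by move=> vu vw; apply: inj; rewrite adj_dist.
exists a', b'; split=> [E|z]; first by apply: ab; rewrite -Ea -Eb E.
split=> [vz|[->|->]] //.
have [|E|E] := (H (f z)).1; first by apply/nbrv; exists z.
  by left; apply: I => //; rewrite Ea.
by right; apply: I => //; rewrite Eb.
Qed.

(** * The two-regular case and the general case *)

Section Rigidity.
Variables (R : realType) (X : graph) (c : nat).
Hypothesis local : forall (m : nat) (Y : graph),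
  is_locally ((c + 3 * m).+1%:R : R) X Y ->
  forall y : Y, exists (p : X -> R) g, [/\ realization p,
    lisom m%:R (vertex_point R y) p g & exists x : X, vdist x p <= c%:R].

Lemma local_two_neighbors (m : nat) (Y : graph) : (0 < m)%N ->
  (forall x : X, two_neighbors x) -> is_locally ((c + 3 * m).+1%:R : R) X Y ->
  forall y : Y, two_neighbors y.
Proof.
move=> m0 H /local loc y; have [p [g [Rp Hg _]]] := loc y.
have Ry := realization_vertex R y.
have Hg1 : lisom 1 (vertex_point R y) p g.
  have [<- _ _ _ _] := Hg.
  apply: (lisom_sub Ry Hg) => //; rewrite gdistxx // add0r.
  by rewrite -[X in X <= _]/(1%:R) ler_nat.
exact: lisom_two_neighbors Hg1 Rp H.
Qed.

Lemma rigid_two_regular : (forall x : X, two_neighbors x) -> LG_rigid R X.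
Proof.
move=> H; have [z Hz] := biwalk_exists H.
have [inj|[N [perN minN]]] := injective_or_period Hz.
  exists (c + 3 * 1).+1%:R => // Y loc.
  have [y Hy] := biwalk_exists (local_two_neighbors (isT : 0 < 1)%N H loc).
  by apply: (covering_of_biwalks Hz Hy) => i j /inj->.
(* The radius [N.+1] about [p] contains every vertex of the cycle [X]: one unit to reach a vertex,
   at most [N] to go on. *)
exists (c + 3 * N.+1).+1%:R => // Y loc.
have [y Hy] := biwalk_exists (local_two_neighbors (isT : 0 < N.+1)%N H loc).
have [p [g [Rp [g1 g2 g3 g4 g5] _]]] := local loc (y 0).
have Ry0 := realization_vertex R (y 0).
have sep (Z : graph) (u v : Z) : u <> v ->
    1 <= gdist (vertex_point R u) (vertex_point R v).
  move=> uv; rewrite gdist_vertices -[X in X <= _]/(1%:R) ler_nat lt0n.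
  by apply/eqP => /dist0_eq.
have By (i : nat) : (i <= N)%N ->
    point_ball (vertex_point R (y 0)) N.+1%:R (vertex_point R (y i%:Z)).
  move=> iN; split; first exact: realization_vertex.
  by rewrite gdist_vertices ler_nat; have := biwalk_dist Hy 0 i; rewrite add0r; lia.
have [P [perP minP] PN] : exists2 P, minimal_period y P & (P <= N)%N.
  (* Otherwise [y 0], ..., [y N] would be distinct and their images would be [N + 1] separated
     points in [X], which has period [N]. *)
  have [i [j [ij jN E]]] : exists i j : nat, [/\ (i < j)%N, (j <= N)%N & y i%:Z = y j%:Z].
    apply: contrapT => Hno.
    apply: (separated_points (q := fun i => g (vertex_point R (y i%:Z))) Hz perN).
      by move=> i /By/g2[].
    move=> i j ij jN; rewrite g3; last exact: By.
      by apply: sep => E; apply: Hno; exists i, j.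
    by apply: By; lia.
  have perij : period y (j - i).
    by apply: (@collision_period _ _ Hy i); [lia | rewrite E; congr y; lia].
  have [injy|[P [perP minP]]] := injective_or_period Hy.
    by have := injy _ _ (perij.2 0); have := perij.1; lia.
  exists P => //; rewrite leqNgt; apply/negP => NP.
  have := minP i j; rewrite E => /(_ _ _ erefl); lia.
(* Conversely, if [P < N], the [N] distinct vertices of [X] would pull back to more than [P]
   separated points of [Y]. *)
have EP : P = N.
  apply/eqP; rewrite eqn_leq PN leqNgt /=; apply/negP => PN'.
  have Bz (i : nat) : (i < N)%N -> point_ball p N.+1%:R (vertex_point R (z i%:Z)).
    move=> iN; split; first exact: realization_vertex.
    have [w Hw] := near_vertex Rp.
    have [i0 Ei0] := biwalk_surj Hz w.
    have [k [m [kN Ek]]] := period_mod i0 perN.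
    have {Ek}Ei0 : w = z k%:Z by rewrite Ei0 Ek (period_mul _ _ perN).
    have Rv := realization_vertex R.
    apply: le_trans (gdist_triangle Rp (Rv X w) (Rv X (z i%:Z))) _.
    rewrite gdistC gdist_vertex // gdist_vertices.
    have : (dist w (z i%:Z) <= N)%N.
      rewrite Ei0; case: (leqP k i) => ki.
        have := biwalk_dist Hz k (i - k)%N; have -> : k%:Z + (i - k)%N%:Z = i by lia.
        by lia.
      have := biwalk_dist Hz i (k - i)%N; have -> : i%:Z + (k - i)%N%:Z = k by lia.
      by rewrite distC; lia.
    by rewrite -(ler_nat R) -(natr1 N); lra.
  have /choice[q Hq] : forall i : nat, exists q, (i < N)%N ->
      point_ball (vertex_point R (y 0)) N.+1%:R q /\ g q = vertex_point R (z i%:Z).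
    move=> i; case: (ltnP i N) => iN; last by exists (vertex_point R (y 0)).
    by have [q Bq Eq] := g5 _ (Bz i iN); exists q.
  apply: (separated_points (q := q) Hy perP).
    by move=> i iP; have [|[]] := Hq i; first by lia.
  move=> i j ij jP; have [|Bi Ei] := Hq i; first by lia.
  have [|Bj Ej] := Hq j; first by lia.
  rewrite -g3 // Ei Ej; apply: sep => E.
  by have := minN i j; rewrite E => /(_ _ _ erefl); lia.
subst P; apply: (covering_of_biwalks Hz Hy) => i j.
have [k [m [kN ->]]] := period_mod i perN; have [l [n [lN ->]]] := period_mod j perN.
by rewrite !(period_mul _ _ perN) !(period_mul _ _ perP) => /minN->.
Qed.

(** A copy [f v] of [v] lies near every vertex. As its degree is not 2, the local isometry reaches
    it from a vertex, and then [lisom_liso] applies. *)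
Lemma local_liso (v : X) : ~ two_neighbors v -> finitely_many_orbits X ->
  forall n : nat, exists2 r : R, 0 < r & forall Y : graph, is_locally r X Y ->
  forall y : Y, exists phi : Y -> X, liso n y phi.
Proof.
move=> Hv /transport[d Hd] n.
(* The copy of [v] is within [d] of [x], hence within [c + d] of [p]. *)
pose m := (n + c + d)%N.
exists (c + 3 * m.+1).+1%:R => // Y loc y.
have [p [g [Rp Hg [x Hx]]]] := local loc y.
have [f [Hf Hfv]] := Hd x v 1%N.
have nfv : ~ two_neighbors (f v) by move=> /(liso_two_neighbors Hf).
have [|u Hu Eu] := lisom_vertex Hg Rp _ nfv.
  have Rv := realization_vertex R.
  apply: le_trans (gdist_triangle Rp (Rv X x) (Rv X (f v))) _.
  rewrite gdistC gdist_vertex // gdist_vertices /m.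
  have : (dist x (f v))%:R <= d%:R :> R by rewrite ler_nat.
  by rewrite !natrD; have := ler0n R n; lra.
have [|phi [Hphi _]] := lisom_liso Hg _ Eu; first by lia.
by exists phi; apply: (liso_sub Hphi); rewrite distxx /m; lia.
Qed.

End Rigidity.

Theorem theorem3 (R : realType) (X : graph)
    (cocompact : isometries_cocompact R X)
    (qi_tree : exists T : graph, is_tree T /\ quasi_isometric R X T) :
  LG_rigid R X.
Proof.
have orbits := cocompact_orbits cocompact.
have [T [treeT /quasi_isometry_vertices[F [L [C HF]]]]] := qi_tree.
have F_upper x y := (HF x y).1; have F_lower x y := (HF x y).2.
have [c local] := locally_lisom R treeT F_upper F_lower orbits.
have [H|/existsNP[v Hv]] := pselect (forall x : X, two_neighbors x).
  exact: rigid_two_regular local H.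
(* Pieces have diameter at most [3 * tripod_const L C]; one more step reaches the adjacent piece, on
   which extensions must also agree. *)
have [rho rho_ge ext] := extension (3 * tripod_const L C).+1 orbits.
have [r r0 Hr] := local_liso local Hv orbits (rho + (3 * tripod_const L C).+1).
exists r => // Y /Hr locY.
apply: covered_by_gluing rho_ge ext locY => o x y s.
exact: (level_component_diameter treeT F_upper F_lower).
Qed.
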